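(* Let $j\in\mathbb{N}$ and $\alpha\in\{-1/2,1/2,\ldots,j-1/2\}\cup(j-1/2,\infty)$. Then there is a constant $C$ such that $$\sup_{u>0}\big\|\partial_u^jR_r^\alpha(u,\cdot)\big\|_{L^2(\mathbb{R}_+)}\le C(1-r)^{-\frac{1+2j}{4}},\qquad r\in(0,1).$$
   Context: $\mathbb{N}=\{0,1,2,\ldots\}$, $\mathbb{R}_+=(0,\infty)$ with Lebesgue measure. For $\alpha>-1$ the Laguerre functions of Hermite type are $\varphi_k^\alpha(u)=\big(\frac{2\Gamma(k+1)}{\Gamma(k+\alpha+1)}\big)^{1/2}L_k^\alpha(u^2)e^{-u^2/2}u^{\alpha+1/2}$, $u>0$, $k\in\mathbb{N}$, where $L_k^\alpha$ is the Laguerre polynomial of degree $k$ and order $\alpha$. The kernel is $$R_r^\alpha(u,v)=\sum_{k\in\mathbb{N}}r^k\varphi_k^\alpha(u)\varphi_k^\alpha(v),\qquad u,v>0,\ r\in(0,1).$$ *)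

(* Defs.v *)
From mathcomp Require Export all_boot all_order all_algebra.
From mathcomp Require Export all_classical all_reals all_analysis.
Export numFieldNormedType.Exports.
Import Order.TTheory GRing.Theory Num.Theory.

Set Implicit Arguments.
Unset Strict Implicit.
Unset Printing Implicit Defensive.

Local Open Scope classical_set_scope.
Local Open Scope ring_scope.

(* Euler's integral; it converges, and hence has the right value, for 0 < s. *)
Definition Gamma (R : realType) (s : R) : R :=
  \int[lebesgue_measure]_(x in `]0, +oo[) (x `^ (s - 1) * expR (- x)).

(* a (a - 1) ... (a - n + 1) / n! for real a. *)
Definition gbinom (R : realType) (a : R) (n : nat) : R :=
  (\prod_(i < n) (a - i%:R)) / (n`!)%:R.

(* L_k^a = sum_(i <= k) (-1)^i binom(k + a, k - i) X^i / i!, so that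
   L_0^a = 1 and L_1^a = 1 + a - X. *)
Definition laguerre (R : realType) (a : R) (k : nat) : {poly R} :=
  \poly_(i < k.+1) ((-1) ^+ i * gbinom (k%:R + a) (k - i) / (i`!)%:R).

Definition laguerre_fun (R : realType) (a : R) (k : nat) (u : R) : R :=
  (2 * Gamma (k%:R + 1) / Gamma (k%:R + a + 1)) `^ (1 / 2)
  * (laguerre a k).[u ^+ 2] * expR (- (u ^+ 2 / 2)) * u `^ (a + 1 / 2).

Definition laguerre_kernel (R : realType) (a r u v : R) : R :=
  limn (series (fun k : nat =>
    r ^+ k * laguerre_fun a k u * laguerre_fun a k v)).

(* The norm of L^2((0, +oo)) for Lebesgue measure; values of f outside
   (0, +oo) are discarded. *)
Definition L2norm_pos (R : realType) (f : R -> R) : \bar R :=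
  ('N[lebesgue_measure]_(2%:E) [EFin \o (f \_ `]0%R, +oo[)])%E.

(* Main.v *)
(* With q = (1 - r)^(1/2) and phi_k = laguerre_fun a k, orthonormality of the
   phi_k bounds the squared norm of d_u^j R_r(u, .) by
   sum_k r^k (d^j phi_k(u))^2, so this sum has to be O(q^-(1 + 2j)), uniformly
   in u.
   For j = 0, put S = sum_k r^k phi_k(u)^2 and g = sum_k r^k phi_k(u) phi_k, so
   that g(u) = S. The derivative of g is (a + 1/2) g / x - h, where h is a
   combination of Laguerre functions of order a + 1 with coefficients of size
   sqrt k. As a >= -1/2, integrating (g^2)' over (u, +oo) gives
   S^2 <= 2 |g|_2 |h|_2, and Bessel's inequality yields |g|_2^2 <= S and
   |h|_2^2 = O(q^-2 S); hence S = O(1 / q).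
   For j > 0, the derivative of phi_k of order a is a combination of Laguerre
   functions of orders a + 1 and a - 1 with coefficients O(sqrt k), and such
   coefficients cost a factor q^-2 in the sum of squares. The order a - 1 does
   not appear when a = -1/2, which is why all half-integers are allowed. *)
Require Import Defs.
From mathcomp Require Import ring lra measurable_realfun.
Import Order.TTheory GRing.Theory Num.Theory.
Set Implicit Arguments.
Unset Strict Implicit.
Unset Printing Implicit Defensive.
Local Open Scope classical_set_scope.
Local Open Scope ring_scope.

(** All estimates are made for sums over k < N with constants independent of N: then S is finite,
    one may divide by it, and the full series is reached by Fatou's lemma. In place of
    Cauchy-Schwarz stands 2 g h <= eps g^2 + eps^-1 h^2 with eps = 1 / q, which balances the two
    integrals. The obstacle is the singular term (a + 1/2) phi_k / u of the derivative. For j = 0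
    its sign is favourable and it is dropped. For j > 0 it is rewritten with the orders a - 1 and a
    + 1, which asks for a - 1 >= -1/2; as j falls together with a, the condition j - 1/2 < a
    survives each step. No formula for the j-th derivative is written down. Families of functions
    indexed by k are shown to be closed under sums, shifts of the index and coefficients of size
    sqrt k, and the derivative is built from these operations. The growth of phi_k in k, on which
    differentiation under the sum rests, is read off from the bound on S itself. *)

Section GeneralizedBinomials.
Context {R : realType}.
Implicit Types (a : R) (n : nat).

Lemma gbinomS a n :
  n.+1%:R * gbinom a n.+1 = (a - n%:R) * gbinom a n.
Proof.
rewrite /gbinom big_ord_recr /= factS natrM.
have h1 : (n`!)%:R != 0 :> R by rewrite pnatr_eq0 -lt0n fact_gt0.
have h2 : n.+1%:R != 0 :> R by rewrite pnatr_eq0.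
by field; rewrite -natr1 in h2; rewrite h1 addrC h2.
Qed.

(** Both sides are a (a - 1) ... (a - n) / n!, with the last or the first factor split off. *)
Lemma gbinom_absorb a n : (a - n%:R) * gbinom a n = a * gbinom (a - 1) n.
Proof.
rewrite /gbinom mulrA [in RHS]mulrA; congr (_ / _).
rewrite mulrC.
transitivity (\prod_(i < n.+1) (a - i%:R)); first by rewrite big_ord_recr.
rewrite big_ord_recl /= subr0; congr (_ * _).
by apply: eq_bigr => i _; rewrite /bump /= natrD; ring.
Qed.

Lemma gbinom_pascal a n :
  gbinom (a + 1) n.+1 = gbinom a n.+1 + gbinom a n.
Proof.
have h2 : n.+1%:R != 0 :> R by rewrite pnatr_eq0.
apply: (mulfI h2); rewrite mulrDr !gbinomS gbinom_absorb addrK.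
by rewrite -natr1; ring.
Qed.

End GeneralizedBinomials.

(** The convention that objects of index -1 are zero, which makes the recurrences below hold at k =
    0 too. *)
Definition delay (V : nmodType) (F : nat -> V) (k : nat) : V :=
  if k is k'.+1 then F k' else 0.

(** * Recurrences between Laguerre polynomials of neighbouring orders *)

Section LaguerreIdentities.
Context {R : realType}.
Implicit Types (a : R) (k n : nat).

Lemma coef_laguerre a k n : (laguerre a k)`_n =
  if (n <= k)%N then (-1) ^+ n * gbinom (k%:R + a) (k - n) / (n`!)%:R else 0.
Proof. by rewrite /laguerre coef_poly ltnS. Qed.

Lemma laguerre0 a : laguerre a 0 = 1.
Proof.
apply/polyP => -[|n]; rewrite coef_laguerre coef1 //=.
by rewrite /gbinom subn0 big_ord0 expr0 mul1r fact0 !divr1.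
Qed.

Lemma deriv_laguerre a k :
  (laguerre a k)^`() = - delay (laguerre (a + 1)) k.
Proof.
case: k => [|k] /=; first by rewrite laguerre0 derivC oppr0.
apply/polyP => n; rewrite coef_deriv coefN !coef_laguerre ltnS.
case: ifP => nk; last by rewrite mul0rn oppr0.
rewrite subSS -natr1 -(addrA k%:R 1) (addrC 1 a).
have h1 : (n`!)%:R != 0 :> R by rewrite pnatr_eq0 -lt0n fact_gt0.
have h2 : n.+1%:R != 0 :> R by rewrite pnatr_eq0.
rewrite factS natrM exprS -[LHS]mulr_natl -natr1; rewrite -natr1 in h2.
by field; rewrite h1 h2.
Qed.

(** Pascal's rule in each coefficient below the leading one, which is the same for both orders. *)
Lemma laguerre_order_succ a k :
  laguerre a k = laguerre (a + 1) k - delay (laguerre (a + 1)) k.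
Proof.
case: k => [|k] /=; first by rewrite !laguerre0 subr0.
apply/polyP => n; rewrite coefB !coef_laguerre.
have [nk|] := leqP n k.
  rewrite leqW // subSn // addrA gbinom_pascal.
  rewrite -natr1 -!(addrA k%:R) (addrC 1 a); ring.
rewrite leq_eqVlt => /predU1P[<-|kn].
  by rewrite leqnn subnn /gbinom !big_ord0 subr0.
by rewrite leqNgt kn /= subr0.
Qed.

(* The Rodrigues formula, one derivative at a time. *)
Lemma laguerre_rodrigues a k : k.+1%:R *: laguerre a k.+1 =
  ((a + 1)%:P - 'X) * laguerre (a + 1) k + 'X * (laguerre (a + 1) k)^`().
Proof.
apply/polyP => n; rewrite coefZ coefD mulrBl coefB coefCM.
rewrite !coefXM coef_deriv !coef_laguerre.
have E : k.+1%:R + a = k%:R + (a + 1) by rewrite -natr1; ring.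
case: n => [|n] /=.
  rewrite !subn0 !expr0 !mul1r fact0 !divr1 subr0 addr0 gbinomS E.
  by congr (_ * _); ring.
have h1 : (n`!)%:R != 0 :> R by rewrite pnatr_eq0 -lt0n fact_gt0.
have h2 : n.+1%:R != 0 :> R by rewrite pnatr_eq0.
rewrite factS natrM exprS ltnS subSS E.
rewrite -natr1 in h2.
have [nk|] := ltnP n k.
  rewrite (ltnW nk).
  have h3 : k%:R - n%:R != 0 :> R by rewrite subr_eq0 eqr_nat gtn_eqF.
  have H := gbinomS (k%:R + (a + 1)) (k - n.+1).
  rewrite subnSK // (natrB _ nk) (natrB _ (ltnW nk)) -(natr1 n) in H.
  (* Both binomials are expressed through one of them, so that the identity becomes rational; k - n
     is nonzero as n < k. *)
  have {}H : gbinom (k%:R + (a + 1)) (k - n) =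
     (a + n%:R + 2) * gbinom (k%:R + (a + 1)) (k - n.+1) / (k%:R - n%:R).
    by apply: (mulfI h3); rewrite H; field.
  rewrite -[X in _ = _ + X]mulr_natl H -!natr1.
  by field; rewrite h1 h2 h3.
rewrite leq_eqVlt => /predU1P[->|kn].
  rewrite leqnn subnn /gbinom !big_ord0 mul0rn -!natr1.
  by field; rewrite h1 h2.
by rewrite (leqNgt n k) kn /= mulr0 mul0rn; ring.
Qed.

(** In degree n this is [gbinom_absorb] with lower index k - n, as a + n = (k + a) - (k - n). It
    serves to trade the factor 1 / u of a Laguerre function for the orders a - 1 and a + 1. *)
Lemma laguerre_order_pred a k : a *: laguerre a k =
  (k%:R + a) *: laguerre (a - 1) k + 'X * delay (laguerre (a + 1)) k.
Proof.
apply/polyP => n; rewrite coefD !coefZ coefXM coef_laguerre [in RHS]coef_laguerre.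
have absorb m : (m + n)%N = k -> (a + n%:R) * gbinom (k%:R + a) m =
    (k%:R + a) * gbinom (k%:R + a - 1) m.
  by move=> <-; rewrite -gbinom_absorb natrD; congr (_ * _); ring.
case: n absorb => [|n] absorb /=.
  rewrite subn0 expr0 !mul1r fact0 !divr1 addr0 addrA.
  by rewrite -absorb ?addn0 // addr0.
have h1 : (n`!)%:R != 0 :> R by rewrite pnatr_eq0 -lt0n fact_gt0.
have h2 : n.+1%:R != 0 :> R by rewrite pnatr_eq0.
case: k absorb => [|k] absorb /=; first by rewrite coef0 !mulr0 addr0.
rewrite coef_laguerre ltnS; case: ifP => nk; last by rewrite !mulr0 addr0.
rewrite subSS; have : (k - n + n.+1 = k.+1)%N by rewrite addnS subnK.
move=> /absorb.
have -> : k%:R + (a + 1) = k.+1%:R + a by rewrite -natr1; ring.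
have -> : k.+1%:R + (a - 1) = k.+1%:R + a - 1 by ring.
rewrite factS natrM exprS.
set B := gbinom _ _; set B' := gbinom _ _ => H.
rewrite -!natr1 in h2 H *.
have -> : (k%:R + 1 + a) * (-1 * (-1) ^+ n * B' / ((n%:R + 1) * n`!%:R)) =
  ((k%:R + 1 + a) * B') * (-1 * (-1) ^+ n / ((n%:R + 1) * n`!%:R)).
  by ring.
by rewrite -H; field; rewrite h1 h2.
Qed.

End LaguerreIdentities.

(** * Integrals over (0, +oo) as limits over compact intervals *)

Section HalfLine.
Context {R : realType}.
Local Notation mu := (@lebesgue_measure R).
Local Notation halfline := (`]0%R, +oo[%classic : set R).

Lemma is_derive_continuous (f : R -> R) (u d : R) :
  is_derive u 1 f d -> {for u, continuous f}.
Proof. by move=> [? _]; exact/differentiable_continuous/derivable1_diffP. Qed.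

(* The squaring map sends exhaust 1 n onto exhaust 2 n. *)
Definition exhaust (m n : nat) : set R :=
  `[(n.+1%:R ^+ m)^-1, n.+1%:R ^+ m].

Lemma exhaust_subset m n : exhaust m n `<=` halfline.
Proof.
move=> x; rewrite /exhaust /= !in_itv /= => /andP[nx _]; rewrite andbT.
by apply: lt_le_trans nx; rewrite invr_gt0 exprn_gt0.
Qed.

Lemma nondecreasing_exhaust m :
  {homo exhaust m : n p / (n <= p)%N >-> (n <= p)%O}.
Proof.
move=> n p np; rewrite subsetEset => x; rewrite /exhaust /= !in_itv /= => /andP[nx xn].
apply/andP; split.
  by apply: le_trans nx; rewrite lef_pV2 ?posrE ?exprn_gt0 // lerXn2r ?nnegrE ?ler_nat.
by apply: (le_trans xn); rewrite lerXn2r ?nnegrE ?ler_nat.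
Qed.

Lemma bigcup_exhaust m : (0 < m)%N -> \bigcup_n exhaust m n = halfline.
Proof.
move=> m0; apply/seteqP; split => [x [n _]|x /=]; first exact: exhaust_subset.
rewrite in_itv /= andbT => x0.
have h y : 0 < y -> y <= (Num.trunc (x + x^-1)).+1%:R -> 
   y <= (Num.trunc (x + x^-1)).+1%:R ^+ m.
  move=> y0 yn; apply: (le_trans yn); rewrite -[leLHS]expr1 ler_weXn2l //.
  by rewrite ler1n.
have xn : x + x^-1 <= (Num.trunc (x + x^-1)).+1%:R.
  by apply: ltW; apply: truncnS_gt.
have x0' : 0 < x^-1 by rewrite invr_gt0.
exists (Num.trunc (x + x^-1)) => //=; rewrite /exhaust /= in_itv /=; apply/andP; split.
  rewrite -[leRHS]invrK lef_pV2 ?posrE ?exprn_gt0 // h //.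
  by apply: le_trans xn; rewrite lerDr ltW.
by apply: h => //; apply: le_trans xn; rewrite lerDl ltW.
Qed.

Lemma ge0_cvg_integral_exhaust m (f : R -> R) : (0 < m)%N ->
  measurable_fun halfline f -> (forall u : R, 0 < u -> 0 <= f u) ->
  (\int[mu]_(u in exhaust m n) (f u)%:E)%E @[n --> \oo] -->
  (\int[mu]_(u in halfline) (f u)%:E)%E.
Proof.
move=> m0 mf f0; rewrite -(bigcup_exhaust m0).
apply: ge0_nondecreasing_set_cvg_integral => //.
- exact: nondecreasing_exhaust.
- by move=> n; exact: measurable_itv.
- move=> n; apply/measurable_EFinP; apply: measurable_funS mf => //.
  exact: exhaust_subset.
- move=> n x /exhaust_subset /=; rewrite in_itv /= andbT => x0.
  by rewrite lee_fin f0.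
Qed.

Lemma cvg_Rintegral_exhaust (f : R -> R) :
  mu.-integrable halfline (EFin \o f) ->
  \int[mu]_(u in exhaust 1 n) f u @[n --> \oo] -->
  \int[mu]_(u in halfline) f u.
Proof.
move=> intf.
have mD : measurable halfline by exact: measurable_itv.
have mE n : measurable (exhaust 1 n) by exact: measurable_itv.
have mf := measurable_int _ intf.
have E n : (\int[mu]_(x in halfline) ((EFin \o f) \_ (exhaust 1 n)) x =
            \int[mu]_(x in exhaust 1 n) (f x)%:E)%E.
  rewrite -integral_mkcondr; congr integral.
  by rewrite setIidr //; exact: exhaust_subset.
have [|||||_ _] := @dominated_convergence _ _ R mu _ mD
  (fun n => (EFin \o f) \_ (exhaust 1 n)) (EFin \o f) (abse \o (EFin \o f)).
- move=> n; apply: measurable_funTS. apply: (measurable_restrictT _ (mE n)).1.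
  by apply: measurable_funS mf => //; exact: exhaust_subset.
- by [].
- apply: aeW => x; have := bigcup_exhaust (ltn0Sn 0) => <- [N _ Nx].
  apply: cvg_near_cst; exists N => // n /= Nn.
  rewrite patchE mem_set //.
  by have := nondecreasing_exhaust 1 Nn; rewrite subsetEset; apply.
- exact: integrable_abse.
- apply: aeW => x n _ /=; rewrite patchE; case: ifP => // _.
  by rewrite abse0.
move=> H; apply: fine_cvg; rewrite fineK.
  by under eq_fun do rewrite -E.
exact: integrable_fin_num.
Qed.

Lemma Rintegral_derive_eq0 (F f : R -> R) :
  mu.-integrable halfline (EFin \o f) ->
  (forall u : R, 0 < u -> {for u, continuous f}) ->
  (forall u : R, 0 < u -> is_derive u 1 F (f u)) ->
  F n.+1%:R^-1 @[n --> \oo] --> (0 : R) -> F n.+1%:R @[n --> \oo] --> (0 : R) ->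
  \int[mu]_(u in halfline) f u = 0.
Proof.
move=> intf cf dF F0 Foo.
suff : \int[mu]_(u in exhaust 1 n) f u @[n --> \oo] --> (0 : R).
  by move=> H; apply: (cvg_unique _ (cvg_Rintegral_exhaust intf) H).
have cF u : 0 < u -> {for u, continuous F}.
  by move=> /dF; exact: is_derive_continuous.
(* The index starts at 1 because [exhaust 1 0] is the single point 1, and the fundamental theorem
   asks for a proper interval. *)
have E n : \int[mu]_(u in exhaust 1 n.+1) f u = F n.+2%:R - F n.+2%:R^-1.
  have n0 : 0 < n.+2%:R^-1 :> R by rewrite invr_gt0.
  have pos u : n.+2%:R^-1 <= u -> 0 < u by exact: lt_le_trans.
  rewrite /Rintegral (@continuous_FTC2 _ f F) ?expr1 //.
  - by rewrite (@lt_trans _ _ 1) // ?ltr1n // invf_lt1 // ltr1n.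
  - apply: continuous_in_subspaceT => x; rewrite inE /= in_itv /= => /andP[/pos x0 _].
    exact: cf.
  - split.
    + by move=> x; rewrite in_itv /= => /andP[/ltW /pos /dF []].
    + exact/cvg_at_right_filter/cF.
    + apply/cvg_at_left_filter/cF; exact: ltr0Sn.
  - move=> x; rewrite in_itv /= => /andP[/ltW /pos x0 _].
    by rewrite derive1E; case: (dF _ x0).
rewrite -cvg_shiftS (funext E).
have Foo' : F n.+2%:R @[n --> \oo] --> (0 : R).
  by rewrite (cvg_shiftS (fun n => F n.+1%:R)).
have F0' : F n.+2%:R^-1 @[n --> \oo] --> (0 : R).
  by rewrite (cvg_shiftS (fun n => F n.+1%:R^-1)).
by have H := cvgB Foo' F0'; rewrite subr0 in H; exact: H.
Qed.

End HalfLine.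

(** * Polynomials in u^2 times a Gaussian and a power of u *)

Section GaussianPolynomials.
Context {R : realType}.
Local Notation mu := (@lebesgue_measure R).
Local Notation halfline := (`]0%R, +oo[%classic : set R).
Implicit Types (t s a u : R) (p q : {poly R}).

(** With t = 1/2 these are Laguerre functions up to a factor, with t = 1 products of two of them. *)
Definition gauss_poly t s p u : R :=
  p.[u ^+ 2] * expR (- (t * u ^+ 2)) * u `^ s.

Lemma gauss_polyD t s p q u :
  gauss_poly t s (p + q) u = gauss_poly t s p u + gauss_poly t s q u.
Proof. by rewrite /gauss_poly hornerD; ring. Qed.

Lemma gauss_polyZ t s c p u :
  gauss_poly t s (c *: p) u = c * gauss_poly t s p u.
Proof. by rewrite /gauss_poly hornerZ; ring. Qed.

Lemma gauss_polyMX t s p u : 0 < u ->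
  gauss_poly t s (p * 'X) u = gauss_poly t (s + 2) p u.
Proof.
move=> u0; rewrite /gauss_poly hornerMX powRD; last by rewrite (gt_eqF u0) implybT.
by rewrite (powR_mulrn 2) ?ltW //; ring.
Qed.

Lemma is_derive_gauss_poly t s p u : 0 < u -> is_derive u 1 (gauss_poly t s p)
  (2 * u * gauss_poly t s (p^`() - t *: p) u + s / u * gauss_poly t s p u).
Proof.
move=> u0.
have dsq : is_derive u 1 (fun v : R => v ^+ 2) (2 * u).
  apply: (is_derive_eq (is_deriveX 2 (is_derive_id u (1 : R)))).
  by rewrite /= expr1 -[_ *: _]/(_ * _) mulr1.
have dp : is_derive u 1 (fun v => p.[v ^+ 2]) (p^`().[u ^+ 2] * (2 * u)).
  exact: (is_derive1_comp (is_derive_poly p _) dsq).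
have de : is_derive u 1 (fun v => expR (- (t * v ^+ 2)))
    (expR (- (t * u ^+ 2)) * (- (t * (2 * u)))).
  exact: (is_derive1_comp (is_derive_expR _) (is_deriveN (is_deriveZ t dsq))).
apply: (is_derive_eq (is_deriveM (is_deriveM dp de) (is_derive1_powR s u0))).
rewrite /gauss_poly /= -![_ *: _]/(_ * _) !fctE hornerD hornerN hornerZ.
rewrite powRB ?(gt_eqF u0) ?implybT // powRr1 ?ltW //.
by field; rewrite gt_eqF.
Qed.

Lemma continuous_gauss_poly t s p u : 0 < u ->
  {for u, continuous (gauss_poly t s p)}.
Proof.
move=> u0; exact: (is_derive_continuous (is_derive_gauss_poly t s p u0)).
Qed.

Lemma measurable_gauss_poly t s p :
  measurable_fun halfline (gauss_poly t s p).
Proof.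
apply: open_continuous_measurable_fun; first exact: interval_open.
by move=> u; rewrite inE /= in_itv /= andbT; exact: continuous_gauss_poly.
Qed.

(** After taking logarithms: ln u <= u, and (s + 1) u - t u^2 is at most its maximum (s + 1)^2 / (4
    t). *)
Lemma powR_gauss_le t s u : 0 < t -> 0 <= s -> 0 < u ->
  expR (- (t * u ^+ 2)) * u `^ s <= expR ((s + 1) ^+ 2 / (4 * t)) * expR (- u).
Proof.
move=> t0 s0 u0; rewrite /powR gt_eqF // -!expRD ler_expR.
have lnu : ln u <= u.
  have := @le_ln1Dx _ (u - 1); rewrite (addrC 1) subrK => /(_ _).
  by rewrite ltrBrDl subrr => /(_ u0); lra.
have slnu : s * ln u <= s * u by rewrite ler_wpM2l.
suff : (s + 1) * u - t * u ^+ 2 <= (s + 1) ^+ 2 / (4 * t) by nra.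
rewrite ler_pdivlMr ?mulr_gt0 //.
have := sqr_ge0 (s + 1 - 2 * t * u); nra.
Qed.

(** Horner induction on p. A factor 'X turns s into s + 2, hence s is general in the induction
    hypothesis. *)
Lemma gauss_poly_le t s p : 0 < t -> 0 <= s ->
  exists2 C : R, 0 <= C & forall u, 0 < u -> `|gauss_poly t s p u| <= C * expR (- u).
Proof.
move=> t0; elim/poly_ind: p s => [|p c IH] s s0.
  by exists 0 => // u _; rewrite /gauss_poly horner0 !mul0r normr0.
have s2 : 0 <= s + 2 by rewrite addr_ge0.
have [C C0 HC] := IH _ s2.
exists (C + `|c| * expR ((s + 1) ^+ 2 / (4 * t))) => [|u u0].
  by rewrite addr_ge0 ?mulr_ge0 ?expR_ge0.
rewrite gauss_polyD gauss_polyMX // (le_trans (ler_normD _ _)) // mulrDl.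
rewrite lerD ?HC // /gauss_poly hornerC -!mulrA normrM ler_wpM2l //.
rewrite ger0_norm ?mulr_ge0 ?expR_ge0 ?powR_ge0 //.
by rewrite mulrA -expr2 powR_gauss_le.
Qed.

Lemma integral_expRN : (\int[mu]_(u in halfline) (expR (- u))%:E = 1)%E.
Proof.
have dF (u : R) : is_derive u 1 (fun v => - expR (- v)) (expR (- u)).
  apply: (is_derive_eq (is_deriveN (is_derive1_comp (is_derive_expR _)
    (is_deriveN (is_derive_id u (1 : R)))))).
  by rewrite mulrN1 opprK.
rewrite integral_itv_obnd_cbnd; last first.
  apply/measurable_EFinP; apply: measurableT_comp => //.
rewrite (@ge0_continuous_FTC2y _ _ (fun u => - expR (- u)) _ 0).
- by rewrite oppr0 expR0 -EFinB sub0r opprK.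
- by move=> u _; exact: expR_ge0.
- apply: continuous_subspaceT => u; apply: continuous_comp.
    exact: opp_continuous.
  exact: continuous_expR.
- rewrite -[X in _ --> X]oppr0; apply: cvgN.
  exact: cvgr_expR.
- by move=> u _; have [] := dF u.
- exact: (cvg_at_right_filter (is_derive_continuous (dF 0))).
- by move=> u _; rewrite derive1E; case: (dF u).
Qed.

Lemma integrable_gauss_poly s p : 0 <= s ->
  mu.-integrable halfline (EFin \o gauss_poly 1 s p).
Proof.
move=> s0; have [C C0 HC] := gauss_poly_le p ltr01 s0.
have mD : measurable halfline by exact: measurable_itv.
have mE : measurable_fun halfline (fun u : R => (expR (- u))%:E).
  by apply/measurable_EFinP; apply: measurableT_comp.
apply: (@le_integrable _ _ R mu _ mD _ (fun u => C%:E * (expR (- u))%:E)%E).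
- by apply/measurable_EFinP; exact: measurable_gauss_poly.
- move=> u; rewrite /= in_itv /= andbT => /HC h; rewrite lee_fin.
  by rewrite [leRHS]ger0_norm // mulr_ge0 ?expR_ge0.
- apply: integrableZl => //; apply/integrableP; split => //.
  under eq_integral do rewrite abse_EFin ger0_norm ?expR_ge0 //.
  by rewrite integral_expRN ltry.
Qed.

End GaussianPolynomials.

(** * Moments against the Laguerre weight, and the Gamma function *)

Section LaguerreMoments.
Context {R : realType}.
Local Notation mu := (@lebesgue_measure R).
Local Notation halfline := (`]0%R, +oo[%classic : set R).
Implicit Types (a s u : R) (p q : {poly R}).

Lemma gauss_polyS t s p u : 0 < u ->
  gauss_poly t (s + 1) p u = u * gauss_poly t s p u.
Proof.
move=> u0; rewrite /gauss_poly powRD ?(gt_eqF u0) ?implybT //.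
by rewrite powRr1 ?ltW //; ring.
Qed.

Lemma cvg0_le_harmonic (x : R^nat) (C : R) :
  (forall n, `|x n| <= C * n.+1%:R^-1) -> x n @[n --> \oo] --> (0 : R).
Proof.
move=> xC.
have H : C * n.+1%:R^-1 @[n --> \oo] --> (0 : R).
  by rewrite -(mulr0 C); apply: cvgMr; exact: cvg_harmonic.
have H' : - (C * n.+1%:R^-1) @[n --> \oo] --> (0 : R).
  by rewrite -oppr0; apply: cvgN.
apply: (squeeze_cvgr _ H' H); apply: nearW => n.
by rewrite -ler_norml xC.
Qed.

(* Substituting x = u ^+ 2, this is half the integral of p against
   x `^ a * expR (- x). *)
Definition moment a p : R :=
  \int[mu]_(u in halfline) gauss_poly 1 (2 * a + 1) p u.

Lemma momentD a p q : 0 <= 2 * a + 1 ->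
  moment a (p + q) = moment a p + moment a q.
Proof.
move=> a0; rewrite /moment -RintegralD //.
- by apply: eq_Rintegral => u _; rewrite gauss_polyD.
- exact: integrable_gauss_poly.
- exact: integrable_gauss_poly.
Qed.

Lemma momentZ a (c : R) p : 0 <= 2 * a + 1 -> moment a (c *: p) = c * moment a p.
Proof.
move=> a0; rewrite /moment -RintegralZl //.
- by apply: eq_Rintegral => u _; rewrite gauss_polyZ.
- exact: integrable_gauss_poly.
Qed.

Lemma momentMX a p : moment a (p * 'X) = moment (a + 1) p.
Proof.
apply: eq_Rintegral => u; rewrite inE /= in_itv /= andbT => u0.
by rewrite gauss_polyMX //; congr gauss_poly; ring.
Qed.

(** The function p(u^2) exp(-u^2) u^(2a+2) vanishes at both ends, so its derivative has integral
    zero; that derivative is twice the difference of the two integrands. *)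
Lemma moment_by_parts a p : 0 <= 2 * a + 1 ->
  moment a ((a + 1) *: p + p^`() * 'X) = moment (a + 1) p.
Proof.
move=> a0.
have a1 : 0 <= 2 * a + 1 + 1 by rewrite addr_ge0.
suff : moment a (2 *: ((a + 1) *: p + p^`() * 'X - p * 'X)) = 0.
  rewrite momentZ // momentD // -scaleN1r momentZ // momentMX => /eqP.
  by rewrite mulf_eq0 pnatr_eq0 /= mulN1r subr_eq0 => /eqP.
apply: (@Rintegral_derive_eq0 _ (gauss_poly 1 (2 * a + 1 + 1) p)).
- exact: integrable_gauss_poly.
- exact: continuous_gauss_poly.
- move=> u u0; apply: (is_derive_eq (is_derive_gauss_poly _ _ _ u0)).
  rewrite !gauss_polyS // /gauss_poly.
  rewrite !(hornerZ, hornerD, hornerN, hornerMX).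
  by field; rewrite gt_eqF.
- have [C C0 HC] := gauss_poly_le p ltr01 a0.
  apply: (@cvg0_le_harmonic _ C) => n.
  have n0 : 0 < n.+1%:R^-1 :> R by rewrite invr_gt0.
  rewrite gauss_polyS // normrM mulrC (ger0_norm (ltW n0)) ler_wpM2r ?(ltW n0) //.
  rewrite (le_trans (HC _ n0)) // ler_piMr // -expR0 ler_expR oppr_le0 ltW //.
- have [C C0 HC] := gauss_poly_le p ltr01 a1.
  apply: (@cvg0_le_harmonic _ C) => n.
  rewrite (le_trans (HC _ _)) // ler_wpM2l // expRN lef_pV2 ?posrE ?expR_gt0 //.
  apply: le_trans (expR_ge1Dx _); rewrite lerDr //.
Qed.

(** The substitution x = u^2 is made on segments away from 0, where x^a may be singular. As the
    integrands are nonnegative, monotone convergence carries the equality to (0, +oo). *)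
Lemma Gamma_moment a : 0 <= 2 * a + 1 -> Gamma (a + 1) = 2 * moment a 1.
Proof.
move=> a0; rewrite /Gamma addrK /moment -RintegralZl //; last first.
  exact: integrable_gauss_poly.
congr fine.
have mf : measurable_fun halfline (fun u : R => u `^ a * expR (- u)).
  apply: measurable_funM; first exact: (measurable_funTS (measurable_powR a)).
  exact: measurableT_comp.
have mg : measurable_fun halfline (fun u => 2 * gauss_poly 1 (2 * a + 1) 1 u).
  by apply: measurable_funM => //; exact: measurable_gauss_poly.
have f0 (u : R) : 0 < u -> 0 <= u `^ a * expR (- u).
  by move=> _; rewrite mulr_ge0 ?powR_ge0 ?expR_ge0.
have g0 u : 0 < u -> 0 <= 2 * gauss_poly 1 (2 * a + 1) 1 u.
  by move=> _; rewrite /gauss_poly hornerC mul1r !mulr_ge0 ?powR_ge0 ?expR_ge0.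
have Hf := ge0_cvg_integral_exhaust (ltn0Sn 1) mf f0.
have Hg := ge0_cvg_integral_exhaust (ltn0Sn 0) mg g0.
suff E n : (\int[mu]_(x in exhaust 2 n) (x `^ a * expR (- x))%:E =
  \int[mu]_(u in exhaust 1 n) (2 * gauss_poly 1 (2 * a + 1) 1 u)%:E)%E.
  by rewrite (funext E) in Hf; exact: (cvg_unique _ Hf Hg).
rewrite /exhaust expr1 -exprVn.
have n0 : 0 < n.+1%:R^-1 :> R by rewrite invr_gt0.
have n1 : n.+1%:R^-1 <= n.+1%:R :> R.
  by rewrite (@le_trans _ _ 1) ?invf_le1 ?ler1n.
have dsq (u : R) : is_derive u 1 (fun v : R => v ^+ 2) (2 * u).
  apply: (is_derive_eq (is_deriveX 2 (is_derive_id u (1 : R)))).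
  by rewrite /= expr1 -[_ *: _]/(_ * _) mulr1.
have csq (u : R) := is_derive_continuous (dsq u).
have dsqE : (fun v : R => v ^+ 2)^`()%classic = (fun u => 2 * u).
  by apply/funext => u; rewrite derive1E; case: (dsq u).
have cd (u : R) : {for u, continuous (fun u : R => 2 * u)}.
  by apply: cvgMr; exact: cvg_id.
rewrite (@integration_by_substitution_increasing _ (fun v : R => v ^+ 2)) //.
- apply: eq_integral => u; rewrite inE /= in_itv /= => /andP[nu _].
  have u0 : 0 < u by exact: lt_le_trans nu.
  congr EFin; rewrite dsqE !fctE gauss_polyS // /gauss_poly hornerC mul1r.
  rewrite powRrM (powR_mulrn 2 (ltW u0)) mul1r.
  by rewrite [LHS]mulrC -!mulrA; congr (_ * (_ * _)); exact: mulrC.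
- move=> x y; rewrite !in_itv /= => /andP[nx _] _ xy.
  have x0 : 0 <= x by rewrite (le_trans (ltW n0)).
  by rewrite ltr_pXn2r // nnegrE ?(le_trans x0) ?ltW.
- by move=> u _; rewrite dsqE; exact: cd.
- by rewrite dsqE; apply/cvg_ex; eexists; apply: cvg_at_right_filter; exact: cd.
- by rewrite dsqE; apply/cvg_ex; eexists; apply: cvg_at_left_filter; exact: cd.
- split.
  + by move=> u _; have [] := dsq u.
  + exact: (cvg_at_right_filter (csq _)).
  + exact: (cvg_at_left_filter (csq _)).
- apply: continuous_in_subspaceT => x; rewrite inE /= in_itv /= => /andP[nx _].
  have x0 : 0 < x by rewrite (lt_le_trans _ nx) // exprn_gt0.
  apply: cvgM; first exact: (is_derive_continuous (is_derive1_powR a x0)).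
  by apply: continuous_comp; [exact: opp_continuous|exact: continuous_expR].
Qed.

Lemma Gamma1 : Gamma 1 = 1 :> R.
Proof.
rewrite /Gamma subrr /Rintegral.
under eq_integral do rewrite powRr0 mul1r.
by rewrite integral_expRN.
Qed.

Lemma GammaS a : 0 <= 2 * a + 1 -> Gamma (a + 1 + 1) = (a + 1) * Gamma (a + 1).
Proof.
move=> a0; rewrite !Gamma_moment ?(le_trans a0) //; last by lra.
rewrite -moment_by_parts // derivC mul0r addr0.
by rewrite momentZ //; ring.
Qed.

Lemma Gamma_gt0 a : 0 <= 2 * a + 1 -> 0 < Gamma (a + 1).
Proof.
move=> a0; rewrite Gamma_moment // mulr_gt0 //.
(* On [1, 2], an interval of length 1, the integrand is at least exp(-4), since u^(2a+1) >= 1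
   there. *)
apply: (@lt_le_trans _ _ (expR (- 4))); first exact: expR_gt0.
have I := integrable_gauss_poly 1 a0.
rewrite -lee_fin /moment /Rintegral fineK; last exact: integrable_fin_num.
have sub : `[1, 2] `<=` halfline.
  by move=> u /=; rewrite !in_itv /= andbT => /andP[u1 _]; rewrite (lt_le_trans _ u1).
have pos u : 0 <= gauss_poly 1 (2 * a + 1) 1 u.
  by rewrite /gauss_poly hornerC mul1r mulr_ge0 ?expR_ge0 ?powR_ge0.
apply: (@le_trans _ _ (\int[mu]_(u in `[1%R, 2%R]) (expR (- 4))%:E)%E).
  by rewrite integral_cst //= lebesgue_measure_itv /= lte_fin ltr1n -EFinB -EFinM lee_fin; lra.
apply: (@le_trans _ _ (\int[mu]_(u in `[1%R, 2%R]) (gauss_poly 1 (2 * a + 1) 1 u)%:E)%E).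
  apply: ge0_le_integral => //.
  - apply/measurable_EFinP; apply: measurable_funS sub (measurable_gauss_poly _ _ _).
    exact: measurable_itv.
  - move=> u /=; rewrite in_itv /= => /andP[u1 u2]; rewrite lee_fin.
    rewrite /gauss_poly hornerC mul1r -[leLHS]mulr1 ler_pM ?expR_ge0 //.
      by rewrite ler_expR lerN2; nra.
    by have := ler_powR u1 a0; rewrite powRr0.
apply: ge0_subset_integral => // [|u _]; last by rewrite lee_fin.
by apply/measurable_EFinP; exact: measurable_gauss_poly.
Qed.

Lemma Gamma_fact n : Gamma (n%:R + 1) = (n`!)%:R :> R.
Proof.
elim: n => [|n IH]; first by rewrite add0r Gamma1 fact0.
by rewrite -natr1 GammaS ?addr_ge0 ?mulr_ge0 // IH factS natrM natr1.
Qed.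

End LaguerreMoments.

(** * Orthonormality and first-order relations of Laguerre functions *)

Section LaguerreFunctions.
Context {R : realType}.
Local Notation mu := (@lebesgue_measure R).
Local Notation halfline := (`]0%R, +oo[%classic : set R).
Implicit Types (a s u : R) (p q : {poly R}) (k l : nat).

Definition laguerre_norm a k : R :=
  (2 * Gamma (k%:R + 1) / Gamma (k%:R + a + 1)) `^ (1 / 2).

Lemma laguerre_normE a k : 0 <= 2 * a + 1 ->
  laguerre_norm a k = Num.sqrt (2 * (k`!)%:R / Gamma (k%:R + a + 1)).
Proof.
move=> a0; rewrite /laguerre_norm mul1r powR12_sqrt Gamma_fact //.
by rewrite divr_ge0 ?mulr_ge0 // ltW // Gamma_gt0 // mulrDr -addrA addr_ge0 ?mulr_ge0.
Qed.

Lemma laguerre_norm_gt0 a k : 0 <= 2 * a + 1 -> 0 < laguerre_norm a k.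
Proof.
move=> a0; have k0 : 0 <= k%:R :> R by [].
rewrite laguerre_normE // sqrtr_gt0 divr_gt0 ?mulr_gt0 ?ltr0n ?fact_gt0 //.
by apply: Gamma_gt0; lra.
Qed.

(** [GammaS] applied to the denominator. This and [laguerre_norm_degree], where only the factorial
    changes, are the origin of the square roots in the derivative formula. *)
Lemma laguerre_norm_order a k : 0 <= 2 * a + 1 ->
  laguerre_norm a k = Num.sqrt (k%:R + a + 1) * laguerre_norm (a + 1) k.
Proof.
move=> a0; have a1 : 0 <= 2 * (a + 1) + 1 by lra.
have k0 : 0 <= k%:R :> R by [].
rewrite !laguerre_normE // -sqrtrM; last by lra.
have G0 : 0 < Gamma (k%:R + a + 1) by apply: Gamma_gt0; lra.
rewrite (_ : k%:R + (a + 1) + 1 = k%:R + a + 1 + 1); last by ring.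
rewrite GammaS; last by lra.
congr Num.sqrt; field; apply/andP; split; apply/lt0r_neq0 => //; lra.
Qed.

Lemma laguerre_norm_degree a k : 0 <= 2 * a + 1 ->
  laguerre_norm a k.+1 = Num.sqrt k.+1%:R * laguerre_norm (a + 1) k.
Proof.
move=> a0; have a1 : 0 <= 2 * (a + 1) + 1 by lra.
rewrite !laguerre_normE // -sqrtrM // factS natrM.
rewrite (_ : k.+1%:R + a + 1 = k%:R + (a + 1) + 1); last by rewrite -natr1; ring.
by congr Num.sqrt; ring.
Qed.

Lemma laguerre_funE a k u : laguerre_fun a k u =
  laguerre_norm a k * gauss_poly (1 / 2) (a + 1 / 2) (laguerre a k) u.
Proof.
rewrite /laguerre_fun /gauss_poly -/(laguerre_norm a k).
by rewrite (_ : 1 / 2 * u ^+ 2 = u ^+ 2 / 2) ?mulrA //; field.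
Qed.

Lemma gauss_polyM s p q u : 0 < u ->
  gauss_poly (1 / 2) s p u * gauss_poly (1 / 2) s q u =
  gauss_poly 1 (2 * s) (p * q) u.
Proof.
move=> u0; rewrite /gauss_poly hornerM.
have -> : 2 * s = s + s by ring.
rewrite powRD ?(gt_eqF u0) ?implybT //.
have -> : - (1 * u ^+ 2) = - (1 / 2 * u ^+ 2) - (1 / 2 * u ^+ 2) by field.
by rewrite expRD; ring.
Qed.

(** Rodrigues' formula and integration by parts move one derivative from the Laguerre polynomial to
    q. *)
Lemma moment_laguerreM a k q : 0 <= 2 * a + 1 ->
  k.+1%:R * moment a (laguerre a k.+1 * q) =
  - moment (a + 1) (laguerre (a + 1) k * q^`()).
Proof.
move=> a0; rewrite -momentZ // scalerAl laguerre_rodrigues.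
set P := laguerre (a + 1) k.
(* The first group is that of [moment_by_parts] for P * q, so its moment cancels against that of P *
   q * 'X. *)
have -> : (((a + 1)%:P - 'X) * P + 'X * P^`()) * q =
  ((a + 1) *: (P * q) + (P * q)^`() * 'X) + (-1) *: (P * q^`() * 'X + P * q * 'X).
  by rewrite derivM -mul_polyC scaleN1r; ring.
rewrite momentD // moment_by_parts // momentZ // momentD // !momentMX; ring.
Qed.

Lemma moment_laguerreSS a k l : 0 <= 2 * a + 1 ->
  k.+1%:R * moment a (laguerre a k.+1 * laguerre a l.+1) =
  moment (a + 1) (laguerre (a + 1) k * laguerre (a + 1) l).
Proof.
move=> a0; rewrite moment_laguerreM // deriv_laguerre /= mulrN -[- (_ * _)]scaleN1r.
by rewrite momentZ ?mulN1r ?opprK //; lra.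
Qed.

Lemma moment_laguerreS0 a k : 0 <= 2 * a + 1 ->
  moment a (laguerre a k.+1 * laguerre a 0) = 0.
Proof.
move=> a0; have h : k.+1%:R != 0 :> R by rewrite pnatr_eq0.
apply: (mulfI h); rewrite moment_laguerreM // deriv_laguerre oppr0 mulr0.
by rewrite -[X in moment _ X](scale0r 0) momentZ ?mul0r ?mulr0 ?oppr0 //; lra.
Qed.

(** Each step lowers both degrees and raises the order by 1, until one degree is 0; for k = l = 0
    the value is fixed by the normalisation 2 / Gamma (a + 1). *)
Lemma moment_laguerre a k l : 0 <= 2 * a + 1 ->
  laguerre_norm a k * laguerre_norm a l *
  moment a (laguerre a k * laguerre a l) = (k == l)%:R.
Proof.
elim: k l a => [|k IH] [|l] a a0.
- rewrite !laguerre0 mulr1 -expr2 laguerre_normE // fact0 add0r.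
  have G0 := Gamma_gt0 a0.
  rewrite sqr_sqrtr ?divr_ge0 ?ltW // Gamma_moment //.
  have : moment a 1 != 0.
    by apply/eqP => m0; move: G0; rewrite Gamma_moment // m0 mulr0 ltxx.
  by move=> m0; rewrite -[RHS]/(1 : R); field.
- by rewrite [laguerre a 0 * _]mulrC moment_laguerreS0 // !mulr0.
- by rewrite moment_laguerreS0 // mulr0.
- have a1 : 0 <= 2 * (a + 1) + 1 by lra.
  rewrite eqSS -(IH l _ a1) -moment_laguerreSS // !laguerre_norm_degree //.
  (* For k = l the two square roots from [laguerre_norm_degree] combine to the factor k + 1 of
     [moment_laguerreSS]; for k <> l they do not, but both moments vanish. *)
  have [<-|kl] := eqVneq k l.
    have S : k.+1%:R = Num.sqrt k.+1%:R * Num.sqrt k.+1%:R :> R.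
      by rewrite -expr2 sqr_sqrtr.
    move: (Num.sqrt _) (laguerre_norm _ _) (moment _ _) S => x y z ->; ring.
  suff -> : moment a (laguerre a k.+1 * laguerre a l.+1) = 0 by rewrite !mulr0.
  have h : k.+1%:R != 0 :> R by rewrite pnatr_eq0.
  apply: (mulfI h); rewrite moment_laguerreSS // mulr0.
  have := IH l _ a1; rewrite (negbTE kl).
  have n0 := laguerre_norm_gt0 k a1; have n1 := laguerre_norm_gt0 l a1.
  have n2 := lt0r_neq0 (mulr_gt0 n0 n1).
  by move=> m0; apply: (mulfI n2); rewrite m0 mulr0.
Qed.

Lemma laguerre_funM a k l u : 0 < u ->
  laguerre_fun a k u * laguerre_fun a l u =
  laguerre_norm a k * laguerre_norm a l *
  gauss_poly 1 (2 * a + 1) (laguerre a k * laguerre a l) u.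
Proof.
move=> u0; have -> : 2 * a + 1 = 2 * (a + 1 / 2) by field.
by rewrite -gauss_polyM // !laguerre_funE mulrACA.
Qed.

Lemma integrable_laguerre_funM a k l : 0 <= 2 * a + 1 -> mu.-integrable halfline
  (EFin \o (fun u => laguerre_fun a k u * laguerre_fun a l u)).
Proof.
move=> a0.
have mD : measurable halfline by exact: measurable_itv.
apply: (@eq_integrable _ _ _ mu _ mD (fun u => (laguerre_norm a k *
  laguerre_norm a l)%:E * (gauss_poly 1 (2 * a + 1)
  (laguerre a k * laguerre a l) u)%:E)%E).
  by move=> u; rewrite inE /= in_itv /= andbT => u0; rewrite laguerre_funM.
by apply: integrableZl => //; exact: integrable_gauss_poly.
Qed.

Lemma laguerre_fun_orthonormal a k l : 0 <= 2 * a + 1 ->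
  \int[mu]_(u in halfline) (laguerre_fun a k u * laguerre_fun a l u) =
  (k == l)%:R.
Proof.
move=> a0; rewrite -(moment_laguerre _ _ a0) /moment -RintegralZl //.
  apply: eq_Rintegral => u; rewrite inE /= in_itv /= andbT => u0.
  by rewrite laguerre_funM.
exact: integrable_gauss_poly.
Qed.

Lemma laguerre_fun_delay a k u : 0 <= 2 * a + 1 ->
  laguerre_norm a k *
    gauss_poly (1 / 2) (a + 1 + 1 / 2) (delay (laguerre (a + 1)) k) u =
  Num.sqrt k%:R * delay (laguerre_fun (a + 1)) k u.
Proof.
move=> a0; case: k => [|k] /=.
  by rewrite /gauss_poly horner0 !mul0r mulr0 sqrtr0 mul0r.
by rewrite laguerre_norm_degree // laguerre_funE -mulrA.
Qed.

(* The coefficient of the singular term vanishes for a = -1/2; for larger a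
   the singular term is removed by laguerre_fun_div below. *)
Lemma is_derive_laguerre_fun a k u : 0 <= 2 * a + 1 -> 0 < u ->
  is_derive u 1 (laguerre_fun a k)
    ((a + 1 / 2) * (laguerre_fun a k u / u) -
     Num.sqrt (k%:R + a + 1) * laguerre_fun (a + 1) k u -
     Num.sqrt k%:R * delay (laguerre_fun (a + 1)) k u).
Proof.
move=> a0 u0.
have -> : laguerre_fun a k = (fun v => laguerre_norm a k *
    gauss_poly (1 / 2) (a + 1 / 2) (laguerre a k) v).
  by apply/funext => v; exact: laguerre_funE.
apply: (is_derive_eq (is_deriveZ _ (is_derive_gauss_poly _ _ _ u0))).
rewrite -[LHS]/(_ * _) deriv_laguerre -laguerre_fun_delay // laguerre_funE.
rewrite (mulrA (Num.sqrt _)) -laguerre_norm_order //.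
set s := delay _ k.
(* With L_k^a written in order a + 1, the factor u in front turns the power for order a into that
   for order a + 1. *)
have -> : - s - 1 / 2 *: laguerre a k = (- 1 / 2) *: (laguerre (a + 1) k + s).
  rewrite (laguerre_order_succ a k) -/s.
  by apply/polyP => n; rewrite !(coefD, coefN, coefZ); field.
have E p : gauss_poly (1 / 2) (a + 1 + 1 / 2) p u =
    u * gauss_poly (1 / 2) (a + 1 / 2) p u.
  by rewrite -gauss_polyS //; congr gauss_poly; ring.
rewrite !E gauss_polyZ gauss_polyD.
move: (gauss_poly _ _ _ u) (gauss_poly _ _ _ u) (gauss_poly _ _ _ u).
by move=> x y z; move: (laguerre_norm a k) => w; field; rewrite gt_eqF.
Qed.

(** This is [laguerre_order_pred] multiplied by the normalisation, the Gaussian and u^(a - 1/2). *)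
Lemma laguerre_fun_div a k u : 0 <= 2 * (a - 1) + 1 -> 0 < u ->
  a * (laguerre_fun a k u / u) =
  Num.sqrt (k%:R + a) * laguerre_fun (a - 1) k u +
  Num.sqrt k%:R * delay (laguerre_fun (a + 1)) k u.
Proof.
move=> a1 u0; have a0 : 0 <= 2 * a + 1 by lra.
have k0 : 0 <= k%:R :> R by [].
rewrite -laguerre_fun_delay // !laguerre_funE (laguerre_norm_order k a1).
rewrite subrK (_ : k%:R + (a - 1) + 1 = k%:R + a); last by ring.
have E p : gauss_poly (1 / 2) (a + 1 / 2) p u =
    u * gauss_poly (1 / 2) (a - 1 + 1 / 2) p u.
  by rewrite -gauss_polyS //; congr gauss_poly; ring.
have E' p : gauss_poly (1 / 2) (a + 1 + 1 / 2) p u =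
    gauss_poly (1 / 2) (a - 1 + 1 / 2) (p * 'X) u.
  by rewrite gauss_polyMX //; congr gauss_poly; ring.
have := laguerre_order_pred a k.
move/(congr1 (fun p => gauss_poly (1 / 2) (a - 1 + 1 / 2) p u)).
rewrite E E' gauss_polyD !gauss_polyZ (mulrC 'X).
have S : Num.sqrt (k%:R + a) ^+ 2 = k%:R + a by rewrite sqr_sqrtr //; lra.
move: (gauss_poly _ _ _ u) (gauss_poly _ _ _ u) (gauss_poly _ _ _ u).
move: (Num.sqrt _) (laguerre_norm _ _) S => q w S x y z H.
transitivity (w * (a * z)); first by field; rewrite gt_eqF.
by rewrite H -S; ring.
Qed.

Lemma laguerre_fun_small a k (e : R) : 0 <= 2 * a + 1 -> 0 < e ->
  exists2 T : R, 0 < T & forall u, T <= u -> `|laguerre_fun a k u| <= e.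
Proof.
move=> a0 e0; have s0 : 0 <= a + 1 / 2 by lra.
have t0 : 0 < 1 / 2 :> R by rewrite divr_gt0.
have [C C0 HC] := gauss_poly_le (laguerre a k) t0 s0.
have n0 := laguerre_norm_gt0 k a0.
have c0 : 0 <= laguerre_norm a k * C by rewrite mulr_ge0 // ltW.
(* As exp u >= u, a bound c exp(-u) is at most e once u >= c / e; the summand 1 makes the threshold
   positive. *)
exists (laguerre_norm a k * C / e + 1) => [|u Tu].
  by rewrite ltr_wpDl // divr_ge0 // ltW.
have u0 : 0 < u by rewrite (lt_le_trans _ Tu) // ltr_wpDl // divr_ge0 // ltW.
rewrite laguerre_funE normrM (gtr0_norm n0).
apply: (@le_trans _ _ (laguerre_norm a k * (C * expR (- u)))).
  by rewrite ler_wpM2l ?HC ?(ltW n0).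
rewrite mulrA expRN ler_pdivrMr ?expR_gt0 //.
apply: (@le_trans _ _ (e * u)).
  by rewrite [leRHS]mulrC -ler_pdivrMr // (le_trans _ Tu) // lerDl.
by rewrite ler_wpM2l ?(ltW e0) // (le_trans _ (expR_ge1Dx u)) // lerDr.
Qed.

End LaguerreFunctions.

(** * Orthogonal systems and Bessel's inequality in its dual form *)

Section Bessel.
Context {R : realType}.
Local Notation mu := (@lebesgue_measure R).
Local Notation halfline := (`]0%R, +oo[%classic : set R).
Implicit Types (F psi : nat -> R -> R) (c : nat -> R).

Let mD : measurable halfline. Proof. exact: measurable_itv. Qed.

Lemma integrable_Rscale (x : R) (f : R -> R) :
  mu.-integrable halfline (EFin \o f) ->
  mu.-integrable halfline (EFin \o (fun u => x * f u)).
Proof.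
move=> If; rewrite (_ : _ \o _ = (fun u => x%:E * (EFin \o f) u)%E).
  exact: integrableZl.
by apply/funext.
Qed.

Lemma integrable_Rsum F N :
  (forall k, mu.-integrable halfline (EFin \o F k)) ->
  mu.-integrable halfline (EFin \o (fun u => \sum_(k < N) F k u)).
Proof.
move=> HF; elim: N => [|N IH].
  rewrite (_ : _ \o _ = cst 0%E); first exact: integrable0.
  by apply/funext => u; rewrite /= big_ord0.
rewrite (_ : _ \o _ = (EFin \o (fun u => (\sum_(k < N) F k u)%R)) \+ (EFin \o F N))%E.
  exact: integrableD.
by apply/funext => u; rewrite /= big_ord_recr.
Qed.

Lemma Rintegral_sum F N :
  (forall k, mu.-integrable halfline (EFin \o F k)) ->
  \int[mu]_(u in halfline) (\sum_(k < N) F k u) =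
  \sum_(k < N) \int[mu]_(u in halfline) F k u.
Proof.
move=> HF; elim: N => [|N IH].
  under eq_Rintegral do rewrite big_ord0.
  by rewrite big_ord0 Rintegral_cst // mul0r.
under eq_Rintegral do rewrite big_ord_recr /=.
by rewrite RintegralD ?IH ?big_ord_recr //; exact: integrable_Rsum.
Qed.

(** Square norms are at most 1 instead of equal to 1, since a delayed orthonormal system begins with
    the zero function. *)
Definition orthobounded psi : Prop := forall k l,
  [/\ mu.-integrable halfline (EFin \o (fun u => psi k u * psi l u)),
      k != l -> \int[mu]_(u in halfline) (psi k u * psi l u) = 0 &
      \int[mu]_(u in halfline) (psi k u * psi k u) <= 1].

Lemma orthobounded_laguerre (a : R) : 0 <= 2 * a + 1 ->
  orthobounded (laguerre_fun a).
Proof.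
move=> a0 k l; split; first exact: integrable_laguerre_funM.
  by move=> kl; rewrite laguerre_fun_orthonormal // (negbTE kl).
by rewrite laguerre_fun_orthonormal // eqxx.
Qed.

Lemma orthobounded_delay psi : orthobounded psi -> orthobounded (delay psi).
Proof.
move=> H.
have Z (f : R -> R) : (forall u, f u = 0) -> \int[mu]_(u in halfline) f u = 0.
  move=> f0; under eq_Rintegral do rewrite f0.
  by rewrite Rintegral_cst // mul0r.
have I (f : R -> R) : (forall u, f u = 0) -> mu.-integrable halfline (EFin \o f).
  move=> f0; rewrite (_ : _ \o _ = cst 0%E); first exact: integrable0.
  by apply/funext => u; rewrite /= f0.
case=> [|k] [|l]; split => //=.
all: try by apply: I => u; rewrite ?mul0r ?mulr0.
all: try by move=> _; apply: Z => u; rewrite ?mul0r ?mulr0.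
all: try by rewrite Z // => u; rewrite mul0r.
all: try by have [] := H k k.
all: by have [] := H k l.
Qed.

Lemma sqr_sum (x : nat -> R) N :
  (\sum_(k < N) x k) ^+ 2 = \sum_(k < N) \sum_(l < N) x k * x l.
Proof.
by rewrite expr2 big_distrl; apply: eq_bigr => k _; rewrite big_distrr.
Qed.

Lemma integrable_sqr_sum psi c N : orthobounded psi ->
  mu.-integrable halfline (EFin \o (fun u => (\sum_(k < N) c k * psi k u) ^+ 2)).
Proof.
move=> H.
rewrite (_ : _ \o _ = EFin \o (fun u =>
    \sum_(k < N) \sum_(l < N) (c k * c l * (psi k u * psi l u)))).
  apply: (integrable_Rsum (F := fun k u =>
    \sum_(l < N) (c k * c l * (psi k u * psi l u)))) => k.
  apply: (integrable_Rsum (F := fun l u => c k * c l * (psi k u * psi l u))) => l.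
  by have [I _ _] := H k l; apply: (integrable_Rscale (c k * c l) I).
apply/funext => u /=; congr EFin; rewrite (sqr_sum (fun k => c k * psi k u)).
by apply: eq_bigr => k _; apply: eq_bigr => l _; rewrite mulrACA.
Qed.

(** In the expanded square the mixed terms integrate to zero and the diagonal ones to at most
    c_k^2. *)
Lemma bessel psi c N : orthobounded psi ->
  \int[mu]_(u in halfline) (\sum_(k < N) c k * psi k u) ^+ 2 <=
  \sum_(k < N) c k ^+ 2.
Proof.
move=> H.
have I k l : mu.-integrable halfline
    (EFin \o (fun u => c k * c l * (psi k u * psi l u))).
  by have [I _ _] := H k l; apply: (integrable_Rscale (c k * c l) I).
rewrite (@eq_Rintegral _ _ _ mu _ (fun u =>
    \sum_(k < N) \sum_(l < N) (c k * c l * (psi k u * psi l u)))); last first.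
  move=> u _; rewrite (sqr_sum (fun k => c k * psi k u)).
  by apply: eq_bigr => k _; apply: eq_bigr => l _; rewrite mulrACA.
rewrite (Rintegral_sum (F := fun k u =>
    \sum_(l < N) (c k * c l * (psi k u * psi l u)))); last first.
  move=> k; exact: (integrable_Rsum (F := fun l u => c k * c l * (psi k u * psi l u))).
apply: ler_sum => k _.
rewrite (Rintegral_sum (F := fun l u => c k * c l * (psi k u * psi l u))) //.
rewrite (bigD1 k) //= big1 ?addr0; last first.
  move=> l lk; have [J J0 _] := H k l.
  by rewrite RintegralZl // J0 ?mulr0 // eq_sym.
have [J _ J1] := H k k.
by rewrite RintegralZl // -expr2 ler_piMr // sqr_ge0.
Qed.

End Bessel.

(** * A one-dimensional Sobolev inequality with a singular term *)

Section SobolevHalfLine.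
Context {R : realType}.
Local Notation mu := (@lebesgue_measure R).
Local Notation halfline := (`]0%R, +oo[%classic : set R).

Let mD : measurable halfline. Proof. exact: measurable_itv. Qed.

Lemma Rintegral_subset (A : set R) (f : R -> R) : measurable A ->
  A `<=` halfline -> mu.-integrable halfline (EFin \o f) ->
  (forall u : R, 0 < u -> 0 <= f u) ->
  \int[mu]_(u in A) f u <= \int[mu]_(u in halfline) f u.
Proof.
move=> mA sA If f0; apply: fine_le.
- by apply: integrable_fin_num => //; exact: integrableS If.
- exact: integrable_fin_num.
- apply: ge0_subset_integral => //; first exact: measurable_int If.
  by move=> u /=; rewrite in_itv /= andbT => /f0; rewrite lee_fin.
Qed.

(* The hypothesis on g gives (g ^+ 2)^`() >= - 2 * g * h, which is integrated
   over (u0, +oo). *)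
Lemma sobolev_halfline (c eps u0 : R) (g h H : R -> R) :
  0 <= c -> 0 < eps -> 0 < u0 ->
  (forall u : R, 0 < u -> is_derive u 1 g (c * (g u / u) - h u)) ->
  (forall u : R, 0 < u -> {for u, continuous h}) ->
  (forall e : R, 0 < e -> exists T, forall u, T <= u -> `|g u| <= e) ->
  mu.-integrable halfline (EFin \o (fun u => g u ^+ 2)) ->
  mu.-integrable halfline (EFin \o H) ->
  (forall u : R, 0 < u -> h u ^+ 2 <= H u) ->
  g u0 ^+ 2 <= eps * \int[mu]_(u in halfline) g u ^+ 2 +
               eps^-1 * \int[mu]_(u in halfline) H u.
Proof.
move=> c0 eps0 u00 dg ch goo Ig IH hH.
pose P u := eps * g u ^+ 2 + eps^-1 * H u.
have IP1 := integrable_Rscale eps Ig.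
have IP2 := integrable_Rscale eps^-1 IH.
have IP : mu.-integrable halfline (EFin \o P).
  rewrite (_ : EFin \o P = (EFin \o (fun u => eps * g u ^+ 2)%R) \+
     (EFin \o (fun u => eps^-1 * H u)%R))%E; first exact: integrableD.
  by apply/funext.
have -> : eps * \int[mu]_(u in halfline) g u ^+ 2 +
    eps^-1 * \int[mu]_(u in halfline) H u = \int[mu]_(u in halfline) P u.
  by rewrite -!RintegralZl // -RintegralD.
have P0 (u : R) : 0 < u -> 0 <= P u.
  move=> u_gt0; rewrite addr_ge0 // mulr_ge0 ?sqr_ge0 ?invr_ge0 ?(ltW eps0) //.
  by rewrite (le_trans _ (hH _ u_gt0)) ?sqr_ge0.
(* The slack e absorbs the boundary term g(T)^2 at a finite endpoint T. *)
apply/ler_addgt0Pr => e e0.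
have se0 : 0 < Num.sqrt e by rewrite sqrtr_gt0.
have [T0 HT0] := goo _ se0.
pose T := Num.max T0 (u0 + 1).
have gT : g T ^+ 2 <= e.
  have /HT0 gT : T0 <= T by rewrite le_max lexx.
  rewrite -(sqr_sqrtr (ltW e0)) -real_normK ?num_real //.
  by rewrite ler_pXn2r ?nnegrE ?normr_ge0 ?(ltW se0).
have u0T : u0 < T by rewrite lt_max ltrDl ltr01 orbT.
have pos (u : R) : u0 <= u -> 0 < u by exact: lt_le_trans.
pose dG u := 2 * g u * (c * (g u / u) - h u).
have dG2 (u : R) : 0 < u -> is_derive u 1 (fun v => g v ^+ 2) (dG u).
  move=> u_gt0; apply: (is_derive_eq (is_deriveX 2 (dg _ u_gt0))).
  by rewrite /= expr1.
have cg (u : R) : 0 < u -> {for u, continuous g}.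
  by move=> u_gt0; exact: is_derive_continuous (dg _ u_gt0).
have cdG (u : R) : 0 < u -> {for u, continuous dG}.
  move=> u_gt0; apply: cvgM.
    by apply: cvgMr; exact: cg.
  apply: cvgB; last exact: ch.
  apply: cvgMr; apply: cvgM; first exact: cg.
  by apply: cvgV; [rewrite gt_eqF|exact: cvg_id].
have cdG' : {within `[u0, T], continuous dG}.
  apply: continuous_in_subspaceT => u; rewrite inE /= in_itv /= => /andP[/pos u_gt0 _].
  exact: cdG.
have mI : measurable (`[u0, T] : set R) by exact: measurable_itv.
have sI : `[u0, T] `<=` halfline.
  by move=> u /=; rewrite !in_itv /= andbT => /andP[/pos].
have IdG : mu.-integrable `[u0, T] (EFin \o dG).
  by apply: continuous_compact_integrable => //; exact: segment_compact.
have FTC : \int[mu]_(u in `[u0, T]) dG u = g T ^+ 2 - g u0 ^+ 2.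
  rewrite /Rintegral (@continuous_FTC2 _ dG (fun v => g v ^+ 2)) //.
  - split.
    + by move=> u; rewrite in_itv /= => /andP[/ltW/pos/dG2[]].
    + exact: (cvg_at_right_filter (is_derive_continuous (dG2 _ u00))).
    + exact: (cvg_at_left_filter (is_derive_continuous (dG2 _ (lt_trans u00 u0T)))).
  - move=> u; rewrite in_itv /= => /andP[/ltW/pos/dG2 d _].
    by rewrite derive1E; case: d.
(* As c >= 0, the singular part of - dG has the good sign and is dropped; the rest is Young's
   inequality, from (eps g - h)^2 >= 0. *)
have pw (u : R) : 0 < u -> - dG u <= P u.
  move=> u_gt0; have := hH _ u_gt0; rewrite /dG /P => hHu.
  have : 0 <= c * g u ^+ 2 / u.
    exact: (divr_ge0 (mulr_ge0 c0 (sqr_ge0 _)) (ltW u_gt0)).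
  have := sqr_ge0 (eps * g u - h u) => sq0 cg0.
  have le2 : 2 * g u * h u <= eps * g u ^+ 2 + eps^-1 * h u ^+ 2.
    rewrite -(ler_pM2l eps0) mulrDr !mulrA divff ?gt_eqF // mul1r.
    by rewrite -subr_ge0 (le_trans sq0) // le_eqVlt; apply/orP; left; apply/eqP; ring.
  have le3 : eps^-1 * h u ^+ 2 <= eps^-1 * H u by rewrite ler_wpM2l // invr_ge0 ltW.
  rewrite (_ : - _ = 2 * g u * h u - 2 * (c * g u ^+ 2 / u)); last first.
    by field; rewrite gt_eqF.
  lra.
have le1 : \int[mu]_(u in `[u0, T]) (- dG u) <= \int[mu]_(u in `[u0, T]) P u.
  apply: le_Rintegral => //.
  - rewrite (_ : _ \o _ = -%E \o (EFin \o dG)); first exact: integrableN.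
    by apply/funext.
  - exact: integrableS IP.
  - move=> u /=; rewrite in_itv /= => /andP[/pos u_gt0 _].
    exact: pw.
have le4 : \int[mu]_(u in `[u0, T]) P u <= \int[mu]_(u in halfline) P u.
  exact: Rintegral_subset.
have E : \int[mu]_(u in `[u0, T]) (- dG u) = - \int[mu]_(u in `[u0, T]) dG u.
  rewrite -mulN1r -RintegralZl //.
  by apply: eq_Rintegral => u _; rewrite mulN1r.
by move: le1; rewrite E FTC opprB lerBlDr => /le_trans; apply; exact: lerD.
Qed.

(** For r < 1 the quotient (1 - r^k) / (1 - r) is a sum of k powers of r, each at least r^k. *)
Lemma mulrn_geom_le (r : R) k : 0 <= r -> r <= 1 ->
  k%:R * r ^+ k * (1 - r) <= 1 - r ^+ k.
Proof.
move=> r0 r1; elim: k => [|k IH]; first by rewrite mul0r mul0r expr0 subrr.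
have rk0 : 0 <= r ^+ k by rewrite exprn_ge0.
have rk1 : r ^+ k <= 1 by rewrite exprn_ile1.
have := ler_wpM2l r0 IH; rewrite -natr1 exprS => IH'.
have : 0 <= (1 - r) * (1 - r * r ^+ k).
  by rewrite mulr_ge0 ?subr_ge0 // mulr_ile1.
nra.
Qed.

End SobolevHalfLine.

(** * The bound O(1 / q) without derivatives *)

Section LaguerreSumBound.
Context {R : realType}.
Local Notation mu := (@lebesgue_measure R).
Local Notation halfline := (`]0%R, +oo[%classic : set R).

Lemma is_derive_sum_ord (F : nat -> R -> R) (D : nat -> R) (u : R) N :
  (forall k, is_derive u 1 (F k) (D k)) ->
  is_derive u 1 (fun v => \sum_(k < N) F k v) (\sum_(k < N) D k).
Proof.
move=> dF; elim: N => [|N IH].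
  rewrite big_ord0 (_ : (fun _ => _) = cst 0); first exact: is_derive_cst.
  by apply/funext => v; rewrite big_ord0.
rewrite big_ord_recr (_ : (fun _ => _) = (fun v => \sum_(k < N) F k v) + F N).
  exact: is_deriveD.
by apply/funext => v; rewrite big_ord_recr.
Qed.

Lemma continuous_lincomb (c : nat -> R) (F : nat -> R -> R) (u : R) N :
  (forall k, {for u, continuous (F k)}) ->
  {for u, continuous (fun v => \sum_(k < N) c k * F k v)}.
Proof.
move=> cF; elim: N => [|N IH].
  rewrite (_ : (fun _ => _) = cst 0); first exact: cst_continuous.
  by apply/funext => v; rewrite big_ord0.
rewrite (_ : (fun _ => _) =
    (fun v => \sum_(k < N) c k * F k v) \+ (fun v => c N * F N v)).
  apply: (cvgD IH); apply: cvgMr; exact: cF.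
by apply/funext => v; rewrite big_ord_recr.
Qed.

(** This is [mulrn_geom_le] for r = 1 - q^2, together with q^2 <= 1. It is the source of the loss
    q^-2 caused by a coefficient of size sqrt k. *)
Lemma affine_geom_le (q c : R) k : 0 < q -> q <= 1 -> 0 <= c ->
  (k%:R + c) * (1 - q ^+ 2) ^+ k <= (1 + c) / q ^+ 2.
Proof.
move=> q0 q1 c0.
have q2 : 0 < q ^+ 2 by rewrite exprn_gt0.
have q21 : q ^+ 2 <= 1 by rewrite exprn_ile1 // ltW.
have r0 : 0 <= 1 - q ^+ 2 by rewrite subr_ge0.
have r1 : 1 - q ^+ 2 <= 1 by rewrite gerBl ltW.
have := mulrn_geom_le k r0 r1.
have : (1 - q ^+ 2) ^+ k <= 1 by rewrite exprn_ile1.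
have : 0 <= (1 - q ^+ 2) ^+ k by rewrite exprn_ge0.
rewrite ler_pdivlMr // opprB addrCA subrr addr0.
move: ((1 - q ^+ 2) ^+ k) => x; move: (q ^+ 2) q2 q21 => y y0 y1 x0 x1 kx.
have : c * x * y <= c * 1 * 1.
  by rewrite -!mulrA ler_wpM2l // ler_pM // ltW.
rewrite !mulrDl; lra.
Qed.

Lemma laguerre_sum_small (a : R) (c : nat -> R) N (e : R) : 0 <= 2 * a + 1 -> 0 < e ->
  exists T, forall u, T <= u -> `|\sum_(k < N) c k * laguerre_fun a k u| <= e.
Proof.
move=> a0; elim: N e => [|N IH] e e0.
  by exists 0 => u _; rewrite big_ord0 normr0 ltW.
have e2 : 0 < e / 2 by rewrite divr_gt0.
have [T HT] := IH _ e2.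
have c0 : 0 < e / 2 / (1 + `|c N|) by rewrite divr_gt0 // ltr_pwDl.
have [T' _ HT'] := laguerre_fun_small N a0 c0.
exists (Num.max T T') => u; rewrite ge_max => /andP[/HT h /HT' h'].
rewrite big_ord_recr /= (le_trans (ler_normD _ _)) // (splitr e) lerD // normrM.
move: h'; rewrite ler_pdivlMr ?ltr_pwDl // => /(le_trans _); apply.
by rewrite mulrC ler_wpM2l // lerDr.
Qed.

Lemma laguerre_sum_bound (a q u : R) N : 0 <= 2 * a + 1 -> 0 < q -> q <= 1 ->
  0 < u -> \sum_(k < N) (1 - q ^+ 2) ^+ k * laguerre_fun a k u ^+ 2 <=
    (2 * a + 7) / q.
Proof.
move=> a0 q0 q1 u0; have a1 : 0 <= 2 * (a + 1) + 1 by lra.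
set r : R := 1 - q ^+ 2; set S : R := \sum_(_ < _) _.
have q2 : 0 < q ^+ 2 by rewrite exprn_gt0.
have q21 : q ^+ 2 <= 1 by rewrite exprn_ile1 // ltW.
have r0 : 0 <= r by rewrite subr_ge0.
have r1 : r <= 1 by rewrite gerBl ltW.
have S0 : 0 <= S by apply: sumr_ge0 => k _; rewrite mulr_ge0 ?sqr_ge0 ?exprn_ge0.
(* The point u is frozen in the coefficients, so that g is a function of v alone and g u = S. *)
pose c k : R := r ^+ k * laguerre_fun a k u.
pose c1 k : R := c k * Num.sqrt (k%:R + a + 1).
pose c2 k : R := c k * Num.sqrt k%:R.
pose g v : R := \sum_(k < N) c k * laguerre_fun a k v.
pose h1 v : R := \sum_(k < N) c1 k * laguerre_fun (a + 1) k v.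
pose h2 v : R := \sum_(k < N) c2 k * delay (laguerre_fun (a + 1)) k v.
have ob := orthobounded_laguerre a0.
have ob1 := orthobounded_laguerre a1.
have ob2 := orthobounded_delay ob1.
have dg (v : R) : 0 < v ->
    is_derive v 1 g ((a + 1 / 2) * (g v / v) - (h1 v + h2 v)).
  move=> v0; have dsum := is_derive_sum_ord N (fun k =>
    is_deriveZ (c k) (is_derive_laguerre_fun k a0 v0)).
  apply: (is_derive_eq dsum); rewrite /g /h1 /h2 mulr_suml mulr_sumr -big_split -sumrB.
  by apply: eq_bigr => k _; rewrite /c1 /c2 -[LHS]/(_ * _) /=; ring.
have ch (v : R) : 0 < v -> {for v, continuous (fun v => h1 v + h2 v)}.
  move=> v0; have cphi k : {for v, continuous (laguerre_fun (a + 1) k)}.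
    exact: (is_derive_continuous (is_derive_laguerre_fun k a1 v0)).
  have cshift k : {for v, continuous (delay (laguerre_fun (a + 1)) k)}.
    by case: k => [|k]; [exact: cvg_cst|exact: cphi].
  have ch1 : {for v, continuous h1} by exact: continuous_lincomb.
  have ch2 : {for v, continuous h2} by exact: continuous_lincomb.
  exact: (cvgD ch1 ch2).
have Ig := integrable_sqr_sum c N ob.
have I1 := integrable_Rscale 2 (integrable_sqr_sum c1 N ob1).
have I2 := integrable_Rscale 2 (integrable_sqr_sum c2 N ob2).
have IH : mu.-integrable halfline
    (EFin \o (fun v => 2 * h1 v ^+ 2 + 2 * h2 v ^+ 2)).
  rewrite (_ : _ \o _ = (EFin \o (fun v => 2 * h1 v ^+ 2)%R) \+
     (EFin \o (fun v => 2 * h2 v ^+ 2)%R))%E; first exact: integrableD.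
  by apply/funext.
have hH v : 0 < v -> (h1 v + h2 v) ^+ 2 <= 2 * h1 v ^+ 2 + 2 * h2 v ^+ 2.
  by move=> _; have := sqr_ge0 (h1 v - h2 v); nra.
have a2 : 0 <= a + 1 / 2 by lra.
have qi : 0 < q^-1 by rewrite invr_gt0.
(* The choice eps = 1 / q is balanced: the integral of g^2 is at most S and that of the majorant of
   h^2 is O(q^-2 S), so both terms are O(S / q). *)
have := sobolev_halfline a2 qi u0 dg ch _ Ig IH hH.
move=> /(_ (fun e => laguerre_sum_small c N a0)); rewrite invrK.
have -> : g u = S.
  by apply: eq_bigr => k _; rewrite /c -mulrA -expr2.
rewrite RintegralD // !RintegralZl ?integrable_sqr_sum //.
have B0 := bessel c N ob; have B1 := bessel c1 N ob1; have B2 := bessel c2 N ob2.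
have C0 : \sum_(k < N) c k ^+ 2 <= S.
  apply: ler_sum => k _; rewrite /c exprMn ler_wpM2r ?sqr_ge0 //.
  by rewrite expr2 ler_piMr ?exprn_ge0 ?exprn_ile1.
(* Since 2 (k + a + 1) + 2 k = 4 (k + (a + 1) / 2), [affine_geom_le] yields the constant 4 (1 + (a +
   1) / 2) = 2 a + 6; the integral of g^2 adds 1, whence 2 a + 7. *)
have C1 : 2 * \sum_(k < N) c1 k ^+ 2 + 2 * \sum_(k < N) c2 k ^+ 2 <=
    (2 * a + 6) / q ^+ 2 * S.
  rewrite !mulr_sumr -big_split /=; apply: ler_sum => k _.
  have k0 : 0 <= k%:R :> R by [].
  have a3 : 0 <= (a + 1) / 2 by lra.
  rewrite /c1 /c2 !(exprMn _ (c k)) !sqr_sqrtr //; last by lra.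
  have := affine_geom_le k q0 q1 a3; rewrite -/r => aff.
  rewrite (_ : 2 * _ + 2 * _ = 4 * ((k%:R + (a + 1) / 2) * r ^+ k *
    (r ^+ k * laguerre_fun a k u ^+ 2))); last first.
    by rewrite /c; move: (r ^+ k) (laguerre_fun a k u) => x y; field.
  rewrite (_ : (2 * a + 6) / q ^+ 2 = 4 * ((1 + (a + 1) / 2) / q ^+ 2)); last first.
    by field; rewrite gt_eqF.
  rewrite -[leRHS]mulrA ler_pM2l // ler_wpM2r //.
  by rewrite mulr_ge0 ?sqr_ge0 ?exprn_ge0.
move=> key.
have {}key : S ^+ 2 <= (2 * a + 7) / q * S.
  apply: (le_trans key).
  rewrite (_ : (2 * a + 7) / q * S = q^-1 * S + q * ((2 * a + 6) / q ^+ 2 * S)).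
    apply: lerD; first by rewrite ler_wpM2l ?(ltW qi) // (le_trans B0).
    rewrite ler_wpM2l ?(ltW q0) // (le_trans _ C1) // lerD // ler_wpM2l //.
  by field; rewrite gt_eqF.
have [S00|Spos] := eqVneq S 0.
  by rewrite S00 divr_ge0 ?(ltW q0) //; lra.
have {}Spos : 0 < S by rewrite lt_neqAle eq_sym Spos.
by move: key; rewrite expr2 ler_pM2r.
Qed.

End LaguerreSumBound.

(** * Families of functions and their closure properties *)

Section Families.
Context {R : realType}.
Implicit Types (F G : nat -> R -> R) (c : nat -> R) (j n : nat).

(** The factor k + 1 in place of k admits constants and nonzero values at k = 0. *)
Definition sqrt_growth c : Prop := exists K : R, forall k, c k ^+ 2 <= K * k.+1%:R.

Lemma sqrt_growthZ (x : R) c : sqrt_growth c -> sqrt_growth (fun k => x * c k).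
Proof.
move=> [K HK]; exists (x ^+ 2 * K) => k.
by rewrite exprMn -mulrA ler_wpM2l ?sqr_ge0.
Qed.

Lemma sqrt_growth_sqrt (b : R) : 0 <= b -> sqrt_growth (fun k => Num.sqrt (k%:R + b)).
Proof.
move=> b0; exists (1 + b) => k; have k0 : 0 <= k%:R :> R by [].
rewrite sqr_sqrtr ?addr_ge0 // -natr1.
have := mulr_ge0 b0 k0; nra.
Qed.

(* The weight is (1 - q ^+ 2) ^+ k, so that q plays the role of (1 - r)^(1/2). *)
Definition sqbound j F : Prop := exists C : R, forall (q u : R) N,
  0 < q -> q <= 1 -> 0 < u ->
  \sum_(k < N) (1 - q ^+ 2) ^+ k * F k u ^+ 2 <= C / q ^+ (1 + 2 * j).

Lemma sqbound_laguerre (a : R) : 0 <= 2 * a + 1 -> sqbound 0 (laguerre_fun a).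
Proof.
by move=> a0; exists (2 * a + 7) => q u N *; rewrite expr1; exact: laguerre_sum_bound.
Qed.

Lemma weight_ge0 (q : R) k : 0 < q -> q <= 1 -> 0 <= (1 - q ^+ 2) ^+ k.
Proof.
by move=> q0 q1; rewrite exprn_ge0 // subr_ge0 exprn_ile1 // ltW.
Qed.

Lemma sqboundD j F G : sqbound j F -> sqbound j G ->
  sqbound j (fun k u => F k u + G k u).
Proof.
move=> [C HC] [D HD]; exists (2 * C + 2 * D) => q u N q0 q1 u0.
apply: (@le_trans _ _ (\sum_(k < N) (2 * ((1 - q ^+ 2) ^+ k * F k u ^+ 2) +
  2 * ((1 - q ^+ 2) ^+ k * G k u ^+ 2)))).
  apply: ler_sum => k _; have := weight_ge0 k q0 q1.
  move: (_ ^+ k) (F k u) (G k u) => w x y w0.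
  rewrite (_ : _ + _ = w * (2 * x ^+ 2 + 2 * y ^+ 2)); last by ring.
  rewrite ler_wpM2l //; have := sqr_ge0 (x - y); nra.
rewrite big_split /= -!mulr_sumr [leRHS]mulrDl.
by rewrite lerD // -mulrA ler_wpM2l ?HC ?HD.
Qed.

(** The shift only brings in a factor 1 - q^2 <= 1. *)
Lemma sqbound_delay j F : sqbound j F -> sqbound j (delay F).
Proof.
move=> [C HC]; exists C => q u [|N] q0 q1 u0.
  by have := HC q u 0 q0 q1 u0; rewrite !big_ord0.
apply: le_trans (HC q u N q0 q1 u0).
rewrite big_ord_recl /= expr0n mulr0 add0r; apply: ler_sum => k _.
rewrite /bump leq0n add1n add0n exprS -mulrA ler_piMl //.
  exact: (mulr_ge0 (weight_ge0 _ q0 q1) (sqr_ge0 _)).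
by rewrite gerBl exprn_ge0 // ltW.
Qed.

(* Halving q spares a factor (1 - (q / 2) ^+ 2) ^+ k that absorbs c k ^+ 2. *)
Lemma sqboundZ j F c : sqrt_growth c -> sqbound j F ->
  sqbound j.+1 (fun k u => c k * F k u).
Proof.
(* With p = q / 2 the bound obtained is K (2 / p^2) C / p^(1+2j), and p^-(3+2j) produces the power
   of 2. *)
move=> [K HK] [C HC]; exists (K * (2 * C) * 2 ^+ (3 + 2 * j)) => q u N q0 q1 u0.
have K0 : 0 <= K.
  by have := HK 0; rewrite mulr1; exact/le_trans/sqr_ge0.
pose p := q / 2.
have p0 : 0 < p by rewrite divr_gt0.
have p1 : p <= 1 by rewrite ler_pdivrMr // mul1r (le_trans q1) // ler1n.
have := HC p u N p0 p1 u0; set S := \sum_(_ < _) _ => HS.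
(* As (1 - q^2 / 4)^2 >= 1 - q^2 / 2, the weight for q is at most the square of that for p: one copy
   is spent on [c k ^+ 2], the other stays in S. *)
have le_w : 1 - q ^+ 2 <= (1 - p ^+ 2) ^+ 2.
  by rewrite /p; have := sqr_ge0 (q ^+ 2); nra.
have q21 : 0 <= 1 - q ^+ 2 by rewrite subr_ge0 exprn_ile1 // ltW.
apply: (@le_trans _ _ (K * (2 / p ^+ 2) * S)).
  rewrite /S mulr_sumr; apply: ler_sum => k _.
  have w0 := weight_ge0 k p0 p1.
  have wk : (1 - q ^+ 2) ^+ k <= (1 - p ^+ 2) ^+ k * (1 - p ^+ 2) ^+ k.
    rewrite -expr2 -exprM mulnC exprM lerXn2r ?nnegrE ?exprn_ge0 //.
    by rewrite subr_ge0 exprn_ile1 // ltW.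
  have := affine_geom_le k p0 p1 ler01; rewrite natr1 => aff.
  rewrite exprMn.
  apply: (@le_trans _ _ ((1 - p ^+ 2) ^+ k * (1 - p ^+ 2) ^+ k *
     (K * k.+1%:R * F k u ^+ 2))).
    apply: ler_pM => //; first exact: weight_ge0.
      by rewrite mulr_ge0 ?sqr_ge0.
    by rewrite ler_wpM2r ?sqr_ge0.
  move: aff w0; move: (_ ^+ k) (F k u ^+ 2) (sqr_ge0 (F k u)) => w x x0 aff w0.
  rewrite (_ : w * w * _ = K * (k.+1%:R * w) * (w * x)); last by ring.
  by rewrite ler_wpM2r ?mulr_ge0 // ler_wpM2l // (le_trans aff).
apply: (@le_trans _ _ (K * (2 / p ^+ 2) * (C / p ^+ (1 + 2 * j)))).
  by rewrite ler_wpM2l // mulr_ge0 // divr_ge0 // ltW // exprn_gt0.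
rewrite le_eqVlt; apply/orP; left; apply/eqP.
have -> : (1 + 2 * j.+1 = 3 + 2 * j)%N by rewrite mulnS addnA.
rewrite /p !expr_div_n !(exprD _ 3 (2 * j)) !(exprD _ 1 (2 * j)) !expr1.
have := expf_neq0 (2 * j) (lt0r_neq0 q0).
have two0 : 2 != 0 :> R by [].
have := expf_neq0 (2 * j) two0.
move: (q ^+ (2 * j)) (2 ^+ (2 * j)) => x y y0 xx0.
by field; rewrite xx0 y0 gt_eqF.
Qed.

(** Growth in k below every exponential rate, locally uniformly in u. Series with weight r^k
    tolerate it, and it is insensitive to factors of size sqrt k. *)
Definition locbounded F : Prop := forall rho x y : R, 0 < rho -> rho < 1 ->
  0 < x -> exists M : R, forall k u, x <= u -> u <= y -> rho ^+ k * `|F k u| <= M.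

Definition derivs F G : Prop :=
  forall k (u : R), 0 < u -> is_derive u 1 (F k) (G k u).

(** Derivatives are given as families instead of through [derive1n], so that the closure lemmas
    follow by induction on n. *)
Fixpoint smooth n F : Prop :=
  locbounded F /\ if n is n'.+1 then exists2 G, derivs F G & smooth n' G else True.

Lemma locboundedD F G : locbounded F -> locbounded G ->
  locbounded (fun k u => F k u + G k u).
Proof.
move=> bF bG rho x y r0 r1 x0.
have [M HM] := bF rho x y r0 r1 x0; have [N HN] := bG rho x y r0 r1 x0.
exists (M + N) => k u xu uy; apply: le_trans (lerD (HM k u xu uy) (HN k u xu uy)).
by rewrite -mulrDr ler_wpM2l ?ler_normD // exprn_ge0 // ltW.
Qed.

Lemma locbounded_delay F : locbounded F -> locbounded (delay F).
Proof.
move=> bF rho x y r0 r1 x0; have [M HM] := bF rho x y r0 r1 x0.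
exists `|M| => -[|k] u xu uy /=; first by rewrite normr0 mulr0.
apply: le_trans (ler_norm M); apply: le_trans (HM k u xu uy).
by rewrite exprS -mulrA ler_piMl ?(ltW r1) // mulr_ge0 // exprn_ge0 // ltW.
Qed.

(** With s = (1 + rho) / 2 one has rho <= s^2 and s < 1; one factor s^k absorbs c_k, the other
    controls F_k. *)
Lemma locboundedZ F c : sqrt_growth c -> locbounded F ->
  locbounded (fun k u => c k * F k u).
Proof.
move=> [K HK] bF rho x y r0 r1 x0.
have d0 : 0 < (1 - rho) / 2 by rewrite divr_gt0 // subr_gt0.
pose s := 1 - (1 - rho) / 2.
have s0 : 0 < s by rewrite /s; lra.
have s1 : s < 1 by rewrite /s; lra.
have rs : rho <= s ^+ 2 by rewrite /s; have := sqr_ge0 ((1 - rho) / 2); lra.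
have [M HM] := bF s x y s0 s1 x0.
have K0 : 0 <= K by have := HK 0; rewrite mulr1; exact/le_trans/sqr_ge0.
exists ((1 + K / (1 - s)) * `|M|) => k u xu uy.
have sk0 : 0 <= s ^+ k by rewrite exprn_ge0 // ltW.
have bc : s ^+ k * `|c k| <= 1 + K / (1 - s).
  have sk1 : s ^+ k <= 1 by rewrite exprn_ile1 // ltW.
  have s1' : 0 < 1 - s by rewrite subr_gt0.
  have geom : k.+1%:R * s ^+ k <= (1 - s)^-1.
    rewrite -[leRHS]mul1r ler_pdivlMr // -natr1 mulrDl mul1r mulrDl.
    have := mulrn_geom_le k (ltW s0) (ltW s1).
    by have := mulr_ge0 sk0 (ltW s0); lra.
  have sc : (s ^+ k * `|c k|) ^+ 2 <= K / (1 - s).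
    rewrite exprMn real_normK ?num_real //.
    apply: (@le_trans _ _ (s ^+ k * (K * k.+1%:R))).
      by rewrite expr2 -mulrA ler_wpM2l // (le_trans _ (HK k)) // ler_piMl ?sqr_ge0.
    by rewrite mulrC -mulrA ler_wpM2l.
  move: sc (sqr_ge0 (s ^+ k * `|c k|)) (sqr_ge0 (s ^+ k * `|c k| - 1)).
  by move: (s ^+ k * `|c k|) (K / (1 - s)) => t L; nra.
apply: (@le_trans _ _ ((s ^+ k * `|c k|) * (s ^+ k * `|F k u|))).
  rewrite normrM mulrACA ler_wpM2r ?mulr_ge0 // -expr2 -exprM mulnC exprM.
  by rewrite lerXn2r ?nnegrE ?(ltW r0) // exprn_ge0 // ltW.
rewrite ler_pM ?mulr_ge0 //; apply: le_trans (HM k u xu uy) (ler_norm M).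
Qed.

(** A single term of a nonnegative sum is at most the sum; q is chosen with 1 - q^2 = rho, and f <=
    1 + f^2 removes the square. *)
Lemma locbounded_sqbound j F : sqbound j F -> locbounded F.
Proof.
move=> [C HC] rho x y r0 r1 x0.
have r2 : 0 <= 1 - rho by rewrite subr_ge0 ltW.
pose q := Num.sqrt (1 - rho).
have q0 : 0 < q by rewrite sqrtr_gt0 subr_gt0.
have q2 : 1 - q ^+ 2 = rho by rewrite sqr_sqrtr // opprB addrC subrK.
have q1 : q <= 1 by rewrite -sqrtr1 ler_wsqrtr // gerBl ltW.
exists (1 + C / q ^+ (1 + 2 * j)) => k u xu _.
have u0 : 0 < u by exact: lt_le_trans xu.
have rk0 : 0 <= rho ^+ k by rewrite exprn_ge0 // ltW.
have rk1 : rho ^+ k <= 1 by rewrite exprn_ile1 // ltW.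
have : rho ^+ k * F k u ^+ 2 <= C / q ^+ (1 + 2 * j).
  apply: le_trans (HC q u k.+1 q0 q1 u0); rewrite q2 big_ord_recr /= lerDr.
  by apply: sumr_ge0 => i _; rewrite mulr_ge0 ?sqr_ge0 // exprn_ge0 // ltW.
rewrite -real_normK ?num_real //.
move: (rho ^+ k) (`|F k u|) rk0 rk1 (normr_ge0 (F k u)) => w f w0 w1 f0 wf.
have := sqr_ge0 (f - 1); nra.
Qed.

Lemma smooth_locbounded n F : smooth n F -> locbounded F.
Proof. by case: n => [|n] []. Qed.

Lemma derivsD F G F' G' : derivs F F' -> derivs G G' ->
  derivs (fun k u => F k u + G k u) (fun k u => F' k u + G' k u).
Proof. by move=> dF dG k u u0; exact: (is_deriveD (dF k u u0) (dG k u u0)). Qed.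

Lemma derivsZ F F' c : derivs F F' ->
  derivs (fun k u => c k * F k u) (fun k u => c k * F' k u).
Proof. by move=> dF k u u0; exact: (is_deriveZ (c k) (dF k u u0)). Qed.

Lemma derivs_delay F F' : derivs F F' -> derivs (delay F) (delay F').
Proof.
move=> dF [|k] u u0; first exact: is_derive_cst.
exact: dF.
Qed.

Lemma smoothD n F G : smooth n F -> smooth n G ->
  smooth n (fun k u => F k u + G k u).
Proof.
elim: n F G => [|n IH] F G [bF HF] [bG HG]; split => //; try exact: locboundedD.
have [F' dF sF] := HF; have [G' dG sG] := HG.
by exists (fun k u => F' k u + G' k u); [exact: derivsD|exact: IH].
Qed.

Lemma smoothZ n F c : sqrt_growth c -> smooth n F -> smooth n (fun k u => c k * F k u).
Proof.
move=> gc; elim: n F => [|n IH] F [bF HF]; split => //; try exact: locboundedZ.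
have [F' dF sF] := HF.
by exists (fun k u => c k * F' k u); [exact: derivsZ|exact: IH].
Qed.

Lemma smooth_delay n F : smooth n F -> smooth n (delay F).
Proof.
elim: n F => [|n IH] F [bF HF]; split => //; try exact: locbounded_delay.
have [F' dF sF] := HF.
by exists (delay F'); [exact: derivs_delay|exact: IH].
Qed.

(** Away from 0 the factor 1 / u is harmless, so for local bounds the singular term may stay.
    Admitting all powers u^-m closes the family under differentiation with orders a and a + 1 alone,
    hence for every a >= -1/2. *)
Lemma smooth_laguerre_div n m (a : R) : 0 <= 2 * a + 1 ->
  smooth n (fun k u => laguerre_fun a k u / u ^+ m).
Proof.
have bdd m' a' : 0 <= 2 * a' + 1 -> locbounded (fun k u => laguerre_fun a' k u / u ^+ m').
  move=> a0 rho x y r0 r1 x0.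
  have [M HM] := locbounded_sqbound (sqbound_laguerre a0) y r0 r1 x0.
  exists (M / x ^+ m') => k u xu uy.
  have u0 : 0 < u by exact: lt_le_trans xu.
  have xm : 0 < x ^+ m' by rewrite exprn_gt0.
  have um : 0 < u ^+ m' by rewrite exprn_gt0.
  rewrite normrM mulrA ler_pM ?mulr_ge0 ?exprn_ge0 ?(ltW r0) ?HM //.
  rewrite ger0_norm ?invr_ge0 ?(ltW um) // lef_pV2 ?posrE //.
  by rewrite lerXn2r ?nnegrE ?(ltW x0) ?(ltW u0).
elim: n m a => [|n IH] m a a0; split => //; try exact: bdd.
have a1 : 0 <= 2 * (a + 1) + 1 by lra.
have a1' : 0 <= a + 1 by lra.
(* The first coefficient joins the singular term to the derivative of u^-m; [k%:R + 0] is written to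
   match [sqrt_growth_sqrt]. *)
exists (fun k u => (a + 1 / 2 - m%:R) * (laguerre_fun a k u / u ^+ m.+1) +
  (-1 * Num.sqrt (k%:R + (a + 1)) * (laguerre_fun (a + 1) k u / u ^+ m) +
  -1 * Num.sqrt (k%:R + 0) * delay (fun k u => laguerre_fun (a + 1) k u / u ^+ m) k u)).
  move=> k u u0.
  have um : u ^+ m != 0 by rewrite expf_neq0 // gt_eqF.
  have dX : is_derive u 1 (fun v : R => v ^+ m) (m%:R * u ^+ m.-1).
    have -> : (fun v : R => v ^+ m) = id ^+ m by apply/funext => v; rewrite exprfctE.
    apply: (is_derive_eq (is_deriveX m (is_derive_id u (1 : R)))).
    by rewrite -[LHS]/(_ * _) mulr1.
  have dV := @is_deriveV _ (fun v : R => v ^+ m) u _ _ um dX.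
  apply: (is_derive_eq (is_deriveM (is_derive_laguerre_fun k a0 u0) dV)).
  rewrite -![_ *: _]/(_ * _) /= addr0 (addrA k%:R).
  have -> : delay (fun k v => laguerre_fun (a + 1) k v / v ^+ m) k u =
      delay (laguerre_fun (a + 1)) k u / u ^+ m.
    by case: (k) => [|k'] //=; rewrite mul0r.
  have -> : m%:R * u ^+ m.-1 = m%:R * (u ^+ m / u).
    by case: (m) => [|m'] /=; rewrite ?mul0r // exprSr mulfK // gt_eqF.
  rewrite (exprS u m); move: (u ^+ m) um (Num.sqrt _) (Num.sqrt _).
  move: (laguerre_fun _ _ _) (laguerre_fun _ _ _) (delay _ _ _) => f g h x x0 y z.
  by field; rewrite x0 gt_eqF.
have c0 : sqrt_growth (fun=> a + 1 / 2 - m%:R).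
  exists ((a + 1 / 2 - m%:R) ^+ 2) => k.
  by rewrite ler_peMr ?sqr_ge0 // ler1n.
apply: smoothD; first exact: (smoothZ c0 (IH _ _ a0)).
apply: smoothD.
  exact: (smoothZ (sqrt_growthZ (-1) (sqrt_growth_sqrt a1')) (IH _ _ a1)).
apply: (smoothZ (sqrt_growthZ (-1) (sqrt_growth_sqrt (lexx 0)))).
exact/smooth_delay/IH.
Qed.

Lemma smooth_laguerre n (a : R) : 0 <= 2 * a + 1 -> smooth n (laguerre_fun a).
Proof.
move=> a0; have := smooth_laguerre_div n 0 a0.
by congr smooth; apply/funext => k; apply/funext => u; rewrite expr0 divr1.
Qed.

End Families.

(** * Differentiation under the sum *)

Section TermwiseDifferentiation.
Context {R : realType}.
Implicit Types (F G H : nat -> R -> R) (b : nat -> R).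

Lemma is_derive_quadratic (f : R -> R) (u l K d : R) : 0 < d ->
  (forall h, `|h| < d -> `|f (h + u) - f u - h * l| <= K * h ^+ 2) ->
  is_derive u 1 f l.
Proof.
move=> d0 Hf.
have K1 : 0 < `|K| + 1 by rewrite ltr_wpDl.
have L : h^-1 *: ((f \o +%R^~ u) (h *: (1 : R)) - f u) @[h --> 0^'] --> l.
  apply/cvgrPdist_le => e e0; near=> h.
  have h0 : h != 0 by near: h; exact: nbhs_dnbhs_neq.
  have hd : `|h| < d by near: h; exact: dnbhs0_lt.
  have he : `|h| < e / (`|K| + 1) by near: h; apply: dnbhs0_lt; rewrite divr_gt0.
  have nh0 : 0 < `|h| by rewrite normr_gt0.
  rewrite /= -[h *: 1]/(h * 1) mulr1 -[_ *: _]/(_ * _).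
  rewrite (_ : l - _ = - (h^-1 * (f (h + u) - f u - h * l))); last by field.
  rewrite normrN normrM normfV mulrC ler_pdivrMr // (le_trans (Hf h hd)) //.
  rewrite -real_normK ?num_real // expr2 mulrA ler_wpM2r ?(ltW nh0) //.
  rewrite (le_trans _ (_ : (`|K| + 1) * `|h| <= _)) //.
    by rewrite ler_wpM2r ?(ltW nh0) // (le_trans (ler_norm K)) // lerDl.
  by rewrite mulrC -ler_pdivlMr // ltW.
split; first by apply/cvg_ex; exists l.
exact: (cvg_lim _ L).
Unshelve. all: by end_near. Qed.

Lemma MVT_increment (f df : R -> R) (u h : R) :
  (forall v, `|v - u| <= `|h| -> is_derive v 1 f (df v)) ->
  exists2 xi, `|xi - u| <= `|h| & f (h + u) - f u = df xi * h.
Proof.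
move=> dF; have [h0|h0] := leP 0 h.
  have bnd v : v \in `[u, h + u] -> `|v - u| <= `|h|.
    rewrite in_itv /= => /andP[uv vh].
    by rewrite !ger0_norm ?subr_ge0 // lerBlDr.
  have [|v /subset_itv_oo_cc /bnd /dF//||c /bnd cb ->] := @MVT_segment _ f df u (h + u).
  - by rewrite lerDr.
  - by apply: derivable_within_continuous => v /bnd /dF [].
  - by exists c => //; rewrite addrK.
have bnd v : v \in `[h + u, u] -> `|v - u| <= `|h|.
  rewrite in_itv /= => /andP[uv vh].
  by rewrite distrC ger0_norm ?subr_ge0 // ltr0_norm // lerBlDr -lerBlDl opprK addrC.
have [|v /subset_itv_oo_cc /bnd /dF//||c /bnd cb E] := @MVT_segment _ f df (h + u) u.
- by rewrite gerDr ltW.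
- by apply: derivable_within_continuous => v /bnd /dF [].
- by exists c => //; rewrite -opprB E; ring.
Qed.

(** The mean value theorem twice, for f and then for g between u and the intermediate point; the
    factor 1/2 of Taylor's formula is given up. *)
Lemma taylor1_le (f g k : R -> R) (u h M : R) :
  (forall v, `|v - u| <= `|h| -> is_derive v 1 f (g v)) ->
  (forall v, `|v - u| <= `|h| -> is_derive v 1 g (k v)) ->
  (forall v, `|v - u| <= `|h| -> `|k v| <= M) ->
  `|f (h + u) - f u - h * g u| <= M * h ^+ 2.
Proof.
move=> df dg kM; have [xi xih ->] := MVT_increment df.
have [|eta etah E] := @MVT_increment g k u (xi - u).
  by move=> v vxi; apply: dg; exact: le_trans xih.
have -> : g xi * h - h * g u = k eta * (xi - u) * h.
  by rewrite -E subrK; ring.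
rewrite !normrM -mulrA -(real_normK (num_real h)) expr2.
rewrite ler_pM ?mulr_ge0 // ?ler_wpM2r //.
by apply: kM; exact: le_trans xih.
Qed.

Definition subexp b : Prop := forall rho : R, 0 < rho -> rho < 1 ->
  exists M : R, forall k, rho ^+ k * `|b k| <= M.

Lemma subexp_locbounded F (v : R) : locbounded F -> 0 < v -> subexp (F ^~ v).
Proof.
move=> bF v0 rho r0 r1; have [M HM] := bF rho v v r0 r1 v0.
by exists M => k; exact: HM.
Qed.

Lemma cvg_series_geometric_le (x : nat -> R) (M s : R) : 0 <= s -> s < 1 ->
  (forall k, `|x k| <= M * s ^+ k) -> cvgn (series x).
Proof.
move=> s0 s1 xM; apply: normed_cvg.
apply: (@series_le_cvg _ _ (geometric M s)) => //.
- by move=> n /=.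
- by move=> n; apply: le_trans (xM n).
- by apply: is_cvg_geometric_series; rewrite ger0_norm.
Qed.

Lemma norm_series_geometric_le (x : nat -> R) (M s : R) n : 0 <= s -> s < 1 ->
  0 <= M -> (forall k, `|x k| <= M * s ^+ k) -> `|series x n| <= M / (1 - s).
Proof.
move=> s0 s1 M0 xM; have s1' : 0 < 1 - s by rewrite subr_gt0.
rewrite /series /=; apply: (le_trans (ler_norm_sum _ _ _)).
apply: (@le_trans _ _ (\sum_(0 <= k < n) M * s ^+ k)); first exact: ler_sum.
rewrite -mulr_sumr ler_wpM2l // -[leRHS]mul1r ler_pdivlMr //.
suff -> : (\sum_(0 <= k < n) s ^+ k) * (1 - s) = 1 - s ^+ n.
  by rewrite gerBl exprn_ge0.
elim: n => [|n IH]; first by rewrite big_geq // expr0 mul0r subrr.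
by rewrite big_nat_recr //= mulrDl IH exprS; ring.
Qed.

(** Bernoulli's inequality for s = 1 - (1 - r) / 3. Of the three factors s^k one will bound F_k, one
    b_k, and one is left over as a geometric sequence. *)
Lemma cube_root_rate (r : R) : 0 < r -> r < 1 ->
  exists s : R, [/\ 0 < s, s < 1 & r <= s * s * s].
Proof.
move=> r0 r1; exists (1 - (1 - r) / 3); split; [lra|lra|].
have := sqr_ge0 ((1 - r) / 3); nra.
Qed.

Lemma norm_term_le (r s f x A B : R) k : 0 < s -> 0 < r -> r <= s * s * s ->
  s ^+ k * `|f| <= A -> s ^+ k * `|x| <= B ->
  `|r ^+ k * f * x| <= A * B * s ^+ k.
Proof.
move=> s0 r0 rs fA xB.
have sk : 0 < s ^+ k by rewrite exprn_gt0.
have : r ^+ k <= s ^+ k * s ^+ k * s ^+ k.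
  by rewrite -!exprMn lerXn2r ?nnegrE ?(ltW r0) // !mulr_ge0 ?(ltW s0).
rewrite !normrM (ger0_norm (exprn_ge0 _ (ltW r0))) => rk.
apply: (@le_trans _ _ (s ^+ k * s ^+ k * s ^+ k * `|f| * `|x|)).
  by rewrite !ler_wpM2r.
rewrite (_ : _ * `|x| = (s ^+ k * `|f|) * (s ^+ k * `|x|) * s ^+ k); last by ring.
by rewrite ler_wpM2r ?(ltW sk) // ler_pM ?mulr_ge0 ?(ltW sk).
Qed.

Lemma cvg_kernel_series F b (r u : R) : 0 < r -> r < 1 -> 0 < u ->
  locbounded F -> subexp b -> cvgn (series (fun k => r ^+ k * F k u * b k)).
Proof.
move=> r0 r1 u0 bF bb; have [s [s0 s1 rs]] := cube_root_rate r0 r1.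
have [A HA] := bF s u u s0 s1 u0; have [B HB] := bb s s0 s1.
apply: (@cvg_series_geometric_le _ (A * B) s) => //; first exact: ltW.
by move=> k; apply: norm_term_le => //; exact: HA.
Qed.

(** The Taylor remainders of the terms are at most h^2 times a geometric sequence, so the remainder
    of the sum is O(h^2). For |h| < u / 2 all points involved lie in [u / 2, 2 u], where H is
    controlled. *)
Lemma is_derive_kernel_series F G H b (r u : R) : 0 < r -> r < 1 -> 0 < u ->
  derivs F G -> derivs G H -> locbounded F -> locbounded G -> locbounded H ->
  subexp b ->
  is_derive u 1 (fun w => limn (series (fun k => r ^+ k * F k w * b k)))
    (limn (series (fun k => r ^+ k * G k u * b k))).
Proof.
move=> r0 r1 u0 dF dG bF bG bH bb; have [s [s0 s1 rs]] := cube_root_rate r0 r1.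
have x0 : 0 < u / 2 by rewrite divr_gt0.
have [A HA] := bH s (u / 2) (2 * u) s0 s1 x0; have [B HB] := bb s s0 s1.
apply: (@is_derive_quadratic _ _ _ (`|A| * `|B| / (1 - s)) (u / 2)) => // h hu.
have near_u v : `|v - u| <= `|h| -> u / 2 <= v /\ v <= 2 * u.
  move=> /le_lt_trans /(_ hu); rewrite ltr_norml => /andP[*]; split; lra.
have pos v : `|v - u| <= `|h| -> 0 < v.
  by move=> /near_u [+ _]; exact: lt_le_trans.
have hu0 : 0 < h + u by apply: pos; rewrite addrK.
have cF w : 0 < w -> cvgn (series (fun k => r ^+ k * F k w * b k)).
  by move=> w0; exact: cvg_kernel_series.
have cG : cvgn (series (fun k => r ^+ k * G k u * b k)).
  exact: cvg_kernel_series.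
pose x k := r ^+ k * (F k (h + u) - F k u - h * G k u) * b k.
have E n : series x n = series (fun k => r ^+ k * F k (h + u) * b k) n -
   series (fun k => r ^+ k * F k u * b k) n -
   h * series (fun k => r ^+ k * G k u * b k) n.
  rewrite /series /= mulr_sumr -!sumrB; apply: eq_bigr => k _; rewrite /x; ring.
have cx : series x n @[n --> \oo] -->
    limn (series (fun k => r ^+ k * F k (h + u) * b k)) -
    limn (series (fun k => r ^+ k * F k u * b k)) -
    h * limn (series (fun k => r ^+ k * G k u * b k)).
  rewrite (funext E); apply: cvgB; first by apply: cvgB; exact: cF.
  by apply: cvgMr; exact: cG.
have xM k : `|x k| <= `|A| * h ^+ 2 * `|B| * s ^+ k.
  apply: norm_term_le => //; last exact: le_trans (HB k) (ler_norm B).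
  have sk0 : 0 < s ^+ k by rewrite exprn_gt0.
  rewrite -ler_pdivlMl // mulrA (mulrC _ `|A|).
  apply: (@taylor1_le (F k) (G k) (H k) u h (`|A| / s ^+ k)).
  - by move=> v /pos; exact: dF.
  - by move=> v /pos; exact: dG.
  - move=> v /near_u[v1 v2]; rewrite ler_pdivlMr // mulrC.
    exact: le_trans (HA k v v1 v2) (ler_norm A).
have M0 : 0 <= `|A| * h ^+ 2 * `|B|  by rewrite mulr_ge0 // mulr_ge0 // sqr_ge0.
apply: (cvgr_to_le (cvg_norm cx)); apply: nearW => n.
rewrite (_ : _ * h ^+ 2 = `|A| * h ^+ 2 * `|B| / (1 - s)); last by ring.
exact: (norm_series_geometric_le n (ltW s0) s1 M0 xM).
Qed.

Lemma derive1n_ext (f g : R -> R) n : (forall u, 0 < u -> f u = g u) ->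
  forall u, 0 < u -> derive1n n f u = derive1n n g u.
Proof.
move=> fg; elim: n => [|n IH] u u0; first exact: fg.
rewrite !derive1nS !derive1E; apply: near_eq_derive.
by near=> v; apply: IH; near: v; exact: lt_nbhsr.
Unshelve. all: by end_near. Qed.

End TermwiseDifferentiation.

(** * Derivatives of the kernel and their norm *)

Section DerivedKernel.
Context {R : realType}.
Local Notation mu := (@lebesgue_measure R).
Local Notation halfline := (`]0%R, +oo[%classic : set R).
Implicit Types (F G : nat -> R -> R) (i j : nat).

(* Two further derivatives are needed at each stage, because series are
   differentiated by means of a second-order Taylor bound. *)
Fixpoint sqsmooth j i F : Prop := smooth 2 F /\
  if i is i'.+1 then exists2 G, derivs F G & sqsmooth j i' G else sqbound j F.

Lemma sqsmoothD j i F G : sqsmooth j i F -> sqsmooth j i G ->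
  sqsmooth j i (fun k u => F k u + G k u).
Proof.
elim: i F G => [|i IH] F G [sF HF] [sG HG].
  by split; [exact: smoothD|exact: sqboundD].
have [F' dF HF'] := HF; have [G' dG HG'] := HG; split; first exact: smoothD.
by exists (fun k u => F' k u + G' k u); [exact: derivsD|exact: IH].
Qed.

Lemma sqsmooth_delay j i F : sqsmooth j i F -> sqsmooth j i (delay F).
Proof.
elim: i F => [|i IH] F [sF HF].
  by split; [exact: smooth_delay|exact: sqbound_delay].
have [F' dF HF'] := HF; split; first exact: smooth_delay.
by exists (delay F'); [exact: derivs_delay|exact: IH].
Qed.

Lemma sqsmoothZ j i F c : sqrt_growth c -> sqsmooth j i F ->
  sqsmooth j.+1 i (fun k u => c k * F k u).
Proof.
move=> gc; elim: i F => [|i IH] F [sF HF].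
  by split; [exact: smoothZ|exact: sqboundZ].
have [F' dF HF'] := HF; split; first exact: smoothZ.
by exists (fun k u => c k * F' k u); [exact: derivsZ|exact: IH].
Qed.

Lemma sqsmooth_laguerre j (a : R) :
  (exists i : nat, a = i%:R - 1 / 2) \/ j%:R - 1 / 2 < a ->
  sqsmooth j j (laguerre_fun a).
Proof.
elim: j a => [|j IH] a ha.
  have a0 : 0 <= 2 * a + 1.
    by case: ha => [[i ->]|]; [have : 0 <= i%:R :> R by []|]; lra.
  by split; [exact: smooth_laguerre|exact: sqbound_laguerre].
have j0 : 0 <= j%:R :> R by [].
have a0 : 0 <= 2 * a + 1.
  case: ha => [[i ->]|]; first by have : 0 <= i%:R :> R by []; lra.
  by rewrite -natr1; lra.
have a1 : 0 <= a + 1 by lra.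
have g1 := sqrt_growthZ (-1) (sqrt_growth_sqrt a1).
have g0 := sqrt_growth_sqrt (lexx (0 : R)).
have IHS : sqsmooth j j (laguerre_fun (a + 1)).
  apply: IH; case: ha => [[i ->]|]; first by left; exists i.+1; rewrite -natr1; ring.
  by rewrite -natr1 => ha; right; lra.
have Sreg := sqsmoothD (sqsmoothZ g1 IHS)
  (sqsmoothZ (sqrt_growthZ (-1) g0) (sqsmooth_delay IHS)).
split; first exact: smooth_laguerre.
have [aE|an] := eqVneq a (- (1 / 2)).
  exists (fun k u => -1 * Num.sqrt (k%:R + (a + 1)) * laguerre_fun (a + 1) k u +
     -1 * Num.sqrt (k%:R + 0) * delay (laguerre_fun (a + 1)) k u); last exact: Sreg.
  move=> k u u0; apply: (is_derive_eq (is_derive_laguerre_fun k a0 u0)).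
  by rewrite addr0 (addrA k%:R) aE; ring.
(* A half-integer other than -1/2 is at least 1/2 here, and the second alternative, now for j + 1,
   gives a > 1/2; so a - 1 is an admissible order. *)
have [a2 IHP] : 0 <= 2 * (a - 1) + 1 /\ sqsmooth j j (laguerre_fun (a - 1)).
  case: ha => [[i ia]|]; last first.
    by rewrite -natr1 => ha; split; [lra|apply: IH; right; lra].
  case: i ia => [ia|i ia]; first by rewrite ia sub0r eqxx in an.
  have i0 : 0 <= i%:R :> R by [].
  move: ia; rewrite -natr1 => ia; split; first by lra.
  by apply: IH; left; exists i; rewrite ia; ring.
have a3 : 0 <= a by lra.
have an0 : a != 0 by apply/eqP => aE; move: a2; rewrite aE; lra.
have g := sqrt_growthZ ((a + 1 / 2) / a) (sqrt_growth_sqrt a3).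
have g' := sqrt_growthZ ((a + 1 / 2) / a) g0.
(* The singular coefficient a + 1/2 is divided by the factor a of [laguerre_fun_div]. *)
exists (fun k u => ((a + 1 / 2) / a * Num.sqrt (k%:R + a) * laguerre_fun (a - 1) k u +
    (a + 1 / 2) / a * Num.sqrt (k%:R + 0) * delay (laguerre_fun (a + 1)) k u) +
    (-1 * Num.sqrt (k%:R + (a + 1)) * laguerre_fun (a + 1) k u +
     -1 * Num.sqrt (k%:R + 0) * delay (laguerre_fun (a + 1)) k u)); last first.
  exact: (sqsmoothD (sqsmoothD (sqsmoothZ g IHP)
    (sqsmoothZ g' (sqsmooth_delay IHS))) Sreg).
move=> k u u0; apply: (is_derive_eq (is_derive_laguerre_fun k a0 u0)).
have -> : laguerre_fun a k u / u = (Num.sqrt (k%:R + a) * laguerre_fun (a - 1) k u +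
    Num.sqrt k%:R * delay (laguerre_fun (a + 1)) k u) / a.
  by rewrite -laguerre_fun_div //; field; rewrite an0 gt_eqF.
rewrite addr0 (addrA k%:R); move: (Num.sqrt _) (Num.sqrt _) (Num.sqrt _).
move: (laguerre_fun _ _ _) (laguerre_fun _ _ _) (delay _ _ _) => x y z p q r.
by field.
Qed.

(** [G] is the i-th derivative of the family and is chosen before r, u and b, so that one constant
    serves them all. The innermost derivative is resolved first, as F carries the data for it. *)
Lemma derive1n_kernel_series j i F : sqsmooth j i F ->
  exists G, [/\ sqbound j G, locbounded G &
    forall (r u : R) (b : nat -> R), 0 < r -> r < 1 -> 0 < u -> subexp b ->
    derive1n i (fun w => limn (series (fun k => r ^+ k * F k w * b k))) u =
    limn (series (fun k => r ^+ k * G k u * b k))].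
Proof.
elim: i F => [|i IH] F [sF HF].
  by exists F; split => //; exact: smooth_locbounded sF.
have [F1 dF1 {}/IH [G [bG lG HG]]] := HF; exists G; split => // r u b r0 r1 u0 bb.
have [lF [F' dF [lF' [F'' dF' [lF'' _]]]]] := sF.
rewrite -HG // /derive1n iterSr; apply: derive1n_ext u0 => v v0.
have [_ D] := is_derive_kernel_series r0 r1 v0 dF dF' lF lF' lF'' bb.
rewrite derive1E D; congr (limn (series _)); apply/funext => k.
(* F' and F1 stem from two separate existentials; both are the derivative of F k at v. *)
by congr (_ * _ * _); case: (dF k v v0) => _ <-; case: (dF1 k v v0).
Qed.

Lemma limn_einf_le (x : (\bar R)^nat) (c : \bar R) :
  (forall n, (x n <= c)%E) -> (limn_einf x <= c)%E.
Proof.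
move=> xc; rewrite limn_einf_lim; apply: lime_le; first exact: is_cvg_einfs.
apply: nearW => n; apply: le_trans (xc n).
by apply: ereal_inf_lbound; exists n => /=.
Qed.

(** Fatou's lemma along the partial sums, whose square integrals are bounded by [bessel]. *)
Lemma integral_sqr_series_le (a C : R) (x : nat -> R) : 0 <= 2 * a + 1 ->
  (forall v : R, 0 < v -> cvgn (series (fun k => x k * laguerre_fun a k v))) ->
  (forall N, \sum_(k < N) x k ^+ 2 <= C) ->
  (\int[mu]_(v in halfline)
    (limn (series (fun k => x k * laguerre_fun a k v)) ^+ 2)%:E <= C%:E)%E.
Proof.
move=> a0 cx xC.
have mD : measurable halfline by exact: measurable_itv.
have ob := orthobounded_laguerre a0.
pose S n v := \sum_(k < n) x k * laguerre_fun a k v.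
have E n v : series (fun k => x k * laguerre_fun a k v) n = S n v.
  by rewrite /series /= big_mkord.
have IS n := integrable_sqr_sum x n ob.
have -> : (\int[mu]_(v in halfline)
    (limn (series (fun k => x k * laguerre_fun a k v)) ^+ 2)%:E =
    \int[mu]_(v in halfline) limn_einf (fun n => (S n v ^+ 2)%:E))%E.
  apply: eq_integral => v; rewrite inE /= in_itv /= andbT => v0.
  have cS : S n v @[n --> \oo] --> limn (series (fun k => x k * laguerre_fun a k v)).
    by under eq_fun do rewrite -E; exact: cx.
  have cS2 : (S n v ^+ 2)%:E @[n --> \oo] -->
      (limn (series (fun k => x k * laguerre_fun a k v)) ^+ 2)%:E.
    by apply: cvg_EFin; [exact: nearW|rewrite !expr2; apply: cvgM].
  by rewrite (cvg_limn_einf_sup cS2).1.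
apply: le_trans.
  apply: fatou => // [n|n v _]; last by rewrite lee_fin sqr_ge0.
  exact: measurable_int (IS n).
apply: limn_einf_le => n.
rewrite -[leLHS]fineK; last exact: integrable_fin_num (IS n).
by rewrite lee_fin; apply: le_trans (xC n); exact: bessel.
Qed.

Lemma L2norm_pos_le (f : R -> R) (C : R) : 0 <= C ->
  (\int[mu]_(v in halfline) (f v ^+ 2)%:E <= C%:E)%E ->
  (L2norm_pos f <= (C `^ 2^-1)%:E)%E.
Proof.
move=> C0 fC; rewrite /L2norm_pos unlock -poweR_EFin.
have -> : (\int[mu]_x (`|(EFin \o (f \_ halfline)) x| `^ 2) =
    \int[mu]_(v in halfline) (f v ^+ 2)%:E)%E.
  rewrite [RHS]integral_mkcond; apply: eq_integral => v _.
  rewrite /= patchE patchE; case: ifPn => _.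
    by rewrite (powR_mulrn 2) // real_normK ?num_real.
  by rewrite -[X in (`|X| `^ _)%:E]/(0 : R) normr0 powR0.
apply: gt0_ler_poweR; rewrite ?invr_ge0 // in_itv /= leey andbT ?lee_fin //.
by apply: integral_ge0 => v _; rewrite lee_fin sqr_ge0.
Qed.

End DerivedKernel.

Theorem proposition4p6 (R : realType) (j : nat) (a : R)
  (ha : (exists2 i : nat, (i <= j)%N & a = i%:R - 1 / 2)
        \/ j%:R - 1 / 2 < a) :
  exists C : R, forall r : R, 0 < r -> r < 1 ->
    (ereal_sup
       [set L2norm_pos (fun v : R =>
              derive1n j (fun w : R => laguerre_kernel a r w v) u)
       | u in `]0%R, +oo[]
     <= (C * (1 - r) `^ (- ((1 + 2 * j%:R) / 4)))%:E)%E.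
Proof.
have j0 : 0 <= j%:R :> R by [].
have a0 : 0 <= 2 * a + 1.
  by case: ha => [[i _ ->]|]; [have : 0 <= i%:R :> R by []|]; lra.
have /sqsmooth_laguerre/derive1n_kernel_series[G [[C HC] lG HG]] :
    (exists i : nat, a = i%:R - 1 / 2) \/ j%:R - 1 / 2 < a.
  by case: ha => [[i _ ia]|]; [left; exists i|right].
have C0 : 0 <= C.
  (* The empty sum at q = 1 turns the bound into 0 <= C. *)
  by have := HC 1 1 0 ltr01 (lexx 1) ltr01; rewrite big_ord0 expr1n divr1.
exists (C `^ 2^-1) => r r0 r1.
apply: ub_ereal_sup => _ [u /= + <-]; rewrite in_itv /= andbT => u0.
have e0 : 0 < 1 - r by rewrite subr_gt0.
pose q := Num.sqrt (1 - r).
have q0 : 0 < q by rewrite sqrtr_gt0.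
have q1 : q <= 1 by rewrite -sqrtr1 ler_wsqrtr // gerBl ltW.
have q2 : 1 - q ^+ 2 = r by rewrite sqr_sqrtr ?(ltW e0) // opprB addrC subrK.
have -> : C `^ 2^-1 * (1 - r) `^ (- ((1 + 2 * j%:R) / 4)) =
    (C / q ^+ (1 + 2 * j)) `^ 2^-1.
  rewrite powRM ?invr_ge0 ?exprn_ge0 ?(ltW q0) //; congr (_ * _).
  rewrite /q -powR12_sqrt ?(ltW e0) // -powR_mulrn ?powR_ge0 //.
  rewrite -powRN -!powRrM natrD natrM; congr (_ `^ _).
  by field.
apply: L2norm_pos_le.
  by rewrite divr_ge0 // exprn_ge0 // ltW.
have bphi v : 0 < v -> subexp ((laguerre_fun a) ^~ v).
  exact/subexp_locbounded/smooth_locbounded/(smooth_laguerre 0).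
rewrite (@eq_integral _ _ _ lebesgue_measure _ (fun v =>
  (limn (series (fun k => r ^+ k * G k u * laguerre_fun a k v)) ^+ 2)%:E)); last first.
  move=> v; rewrite inE /= in_itv /= andbT => v0.
  by rewrite -(HG r u _ r0 r1 u0 (bphi v v0)).
apply: (@integral_sqr_series_le _ a _ (fun k => r ^+ k * G k u)) => // [v v0|N].
  exact: cvg_kernel_series (bphi v v0).
(* The squared coefficients carry r^(2k), of which one factor r^k <= 1 is dropped. *)
apply: le_trans (HC q u N q0 q1 u0); rewrite q2; apply: ler_sum => k _.
rewrite exprMn ler_wpM2r ?sqr_ge0 // expr2 ler_piMr ?exprn_ge0 ?exprn_ile1 ?(ltW r0) //.
exact: ltW.
Qed.
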